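(* Let $\mu$ be a probability measure on $(0,\infty)$ with $0\in\mathrm{supp}(\mu)$ and let $g(s)=\sum_{n\ge1}a_nn^{-s}$ be a non-constant (convergent) Dirichlet series. Then $T_g:\mathcal{A}^2_\mu\to\mathcal{A}^2_\mu$ is not in the Schatten class $S_p$ for any $0<p<\infty$.
   Context: For $n\ge1$ let $w_n=\int_0^\infty n^{-2\sigma}\,d\mu(\sigma)$. The space $\mathcal{A}^2_\mu$ is the Hilbert space of Dirichlet series $f(s)=\sum_{n\ge1}a_nn^{-s}$ with $\|f\|_{\mathcal{A}^2_\mu}=\left(\sum_{n\ge1}|a_n|^2w_n\right)^{1/2}<\infty$. For a convergent Dirichlet series $g$ and a convergent Dirichlet series $f$, the Volterra operator is $T_gf(s)=-\int_s^\infty f(w)g'(w)\,dw$ (integration along the horizontal half-line, $\mathrm{Re}(s)$ large), again a convergent Dirichlet series. *)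

(* Defs.v *)
From HB Require Import structures.
From mathcomp Require Import all_boot all_order all_algebra.
From mathcomp Require Import complex.
From mathcomp Require Import all_classical all_reals all_analysis.
Set Implicit Arguments.
Unset Strict Implicit.
Unset Printing Implicit Defensive.
Import Order.TTheory GRing.Theory Num.Theory numFieldNormedType.Exports.
Import ComplexField.Normc.
Local Open Scope classical_set_scope.
Local Open Scope ring_scope.
Local Open Scope complex_scope.

(* A Dirichlet series is given by its coefficients; the term with index k of
   a sequence [a] is the coefficient of (k + 1)^(-s), so that the sum ranges
   over the positive integers n = k + 1. Limits and derivatives of complex
   functions are taken in [R[i]^o], i.e. R[i] with the topology of its norm and
   as a normed space over itself; derivatives are thus complex derivatives. *)

Definition cexp (R : realType) (z : R[i]) : R[i] :=
  (expR (complex.Re z))%:C * (cos (complex.Im z) +i* sin (complex.Im z)).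

Definition npow (R : realType) (n : nat) (s : R[i]) : R[i] :=
  cexp (- s * (ln n%:R)%:C).

Definition dseries (R : realType) (a : nat -> R[i]) (s : R[i]) : R[i]^o ^nat :=
  series (fun k => a k * npow k.+1 s : R[i]^o).

Definition dsum (R : realType) (a : nat -> R[i]) (s : R[i]) : R[i] :=
  limn (dseries a s).

Definition dconvergent (R : realType) (a : nat -> R[i]) : Prop :=
  exists s, cvgn (dseries a s).

Definition dconstant (R : realType) (a : nat -> R[i]) : Prop :=
  forall k, (0 < k)%N -> a k = 0.

Definition cderive (R : realType) (f : R[i] -> R[i]) (z : R[i]) : R[i] :=
  derive1 (f : R[i]^o -> R[i]^o) z.

(* The integral of F(w) dw over the half-line w = s + t, t >= 0. *)
Definition halfline_integral (R : realType) (F : R[i] -> R[i]) (s : R[i])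
    : R[i] :=
  (\int[@lebesgue_measure R]_(t in `[0, +oo[) complex.Re (F (s + t%:C)))
  +i* (\int[@lebesgue_measure R]_(t in `[0, +oo[) complex.Im (F (s + t%:C))).

Definition is_volterra (R : realType) (g f h : nat -> R[i]) : Prop :=
  dconvergent h /\
  exists sigma0 : R, forall s : R[i], sigma0 < complex.Re s ->
    dsum h s = - halfline_integral (fun w => dsum f w * cderive (dsum g) w) s.

(* For convergent f and g there is exactly one such h: a convergent Dirichlet
   series is determined by its values on a right half-plane. *)
Definition volterra (R : realType) (g f : nat -> R[i]) : nat -> R[i] :=
  xget (fun=> 0) [set h | is_volterra g f h].

Definition msupport (R : realType)
    (mu : {measure set (measurableTypeR R) -> \bar R}) : set R :=
  [set x : R | forall U : set R, open U -> U x -> (0 < mu U)%E].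

Section bergman.
Context (R : realType) (mu : {measure set (measurableTypeR R) -> \bar R}).
Implicit Types (f g : nat -> R[i]) (T : (nat -> R[i]) -> nat -> R[i]).

Definition weight (k : nat) : R :=
  \int[mu]_(x in `]0, +oo[) (k.+1%:R `^ (- (2 * x))).

Definition A2norm2 f : \bar R :=
  (\sum_(0 <= k <oo) (normc (f k) ^+ 2 * weight k)%:E)%E.

Definition A2 : set (nat -> R[i]) := [set f | (A2norm2 f < +oo)%E].

Definition A2norm f : R := Num.sqrt (fine (A2norm2 f)).

Definition A2dot f g : R[i] :=
  limn (series (fun k => f k * (g k)^*%C * (weight k)%:C : R[i]^o)).

Definition A2linear T : Prop :=
  forall (c : R[i]) f g, A2 f -> A2 g ->
    T (fun k => c * f k + g k) = fun k => c * T f k + T g k.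

Definition A2bounded T : Prop :=
  exists M : R, forall f, A2 f -> A2 (T f) /\ A2norm (T f) <= M * A2norm f.

Definition A2compact T : Prop :=
  forall u : nat -> nat -> R[i],
    (forall n, A2 (u n) /\ A2norm (u n) <= 1) ->
    exists (phi : nat -> nat) (h : nat -> R[i]),
      [/\ {homo phi : m n / (m < n)%N}, A2 h &
        A2norm (fun k => T (u (phi n)) k - h k) @[n --> \oo] --> (0 : R)].

Definition A2adjoint T Tstar : Prop :=
  (forall g, A2 g -> A2 (Tstar g)) /\
  forall f g, A2 f -> A2 g -> A2dot (T f) g = A2dot f (Tstar g).

Definition A2orthonormal (e : nat -> nat -> R[i]) : Prop :=
  (forall n, A2 (e n)) /\ forall m n, A2dot (e m) (e n) = (m == n)%:R.

(* The singular values of T are the eigenvalues of |T| = (T^* T)^(1/2), in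
   nonincreasing order and repeated according to multiplicity. They are
   described through an orthonormal sequence of eigenvectors of T^* T, with
   eigenvalues (s n)^2, that exhausts the orthogonal complement of ker T. If T
   has finite rank the sequence is completed by vectors of ker T, for which
   s n = 0. *)
Definition singular_values T (s : nat -> R) : Prop :=
  [/\ forall n, 0 <= s n, nonincreasing_seq s &
    exists Tstar (e : nat -> nat -> R[i]),
      [/\ A2adjoint T Tstar, A2orthonormal e,
        forall n, Tstar (T (e n)) = (fun k => ((s n) ^+ 2)%:C * e n k) &
        forall f, A2 f -> (forall n, A2dot f (e n) = 0) -> T f = fun=> 0]].

Definition schatten_class (p : R) T : Prop :=
  [/\ A2linear T, A2bounded T, A2compact T &
    exists2 s : nat -> R, singular_values T s &
      (\sum_(0 <= n <oo) (s n `^ p)%:E < +oo)%E].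

End bergman.

(* Main.v *)
Require Import Defs.
From HB Require Import structures.
From mathcomp Require Import all_boot all_order all_algebra.
From mathcomp Require Import complex ring lra zify.
From mathcomp Require Import all_classical all_reals all_analysis.
From mathcomp Require Import measurable_realfun.
Import Order.TTheory GRing.Theory Num.Theory numFieldNormedType.Exports.
Import ComplexField.Normc.
Set Implicit Arguments.
Unset Strict Implicit.
Unset Printing Implicit Defensive.
Local Open Scope classical_set_scope.
Local Open Scope ring_scope.
Local Open Scope complex_scope.

(* Put b_m(s) = (m+1)^(-s) / sqrt(w_{m+1}), an orthonormal sequence, and let
   a_k <> 0 be a coefficient of g with k >= 2. The coefficient of T_g b_m at
   k (m+1) is a_k log k / log (k (m+1)) / sqrt(w_{m+1}), and Chebyshev's
   association inequality gives w_{jk} >= w_j w_k, so that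
   |T_g b_m|^2 >= c / (log (k (m+1)))^2 with c > 0 independent of m.
   Diagonalising T_g^* T_g, for all N and K,
     sum_{m < N} |T_g b_m|^2 <= s_0^2 K + s_K^2 N.
   If sum s_n^p is finite then s_K <= (C / K)^(1/p), and N = K^2 gives
   c <= (log (k K^2))^2 (s_0^2 / K + s_K^2), up to bounded shifts in the
   logarithm, which tends to 0 as K grows. *)

(** * Convergence in R[i] *)

Section complex_series.
Context {R : realType}.
Implicit Types (z : R[i]) (u : nat -> R[i]).

(** Logarithmic decay of |T_g b_m| against power decay of s_n is what lets one argument cover all p,
    below and above 2. The upper bound comes from |T f|^2 = sum_n s_n^2 |<f, e_n>|^2 with f = b_m.
    For n < K use s_n <= s_0 and sum over m: Bessel's inequality for e_n against the b_m gives at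
    most 1 for each n, hence s_0^2 K. For n >= K use s_n <= s_K: Bessel for b_m against the e_n
    gives s_K^2 for each m, hence s_K^2 N. N must outgrow K by a power, so that K / N absorbs the
    logarithms, while log N stays comparable with log K; this dictates N = K^2. The association
    inequality keeps the ratio w_{k(m+1)} / w_{m+1} above w_k, uniformly in m. Since
    [singular_values] only supplies an orthonormal sequence of eigenvectors, the bound on |T f|^2 is
    derived by expanding f along the e_n coefficient by coefficient. T_g is computed on monomials
    only; its linearity and boundedness come with [schatten_class]. *)

Lemma normcE z : `|z| = (normc z)%:C. Proof. by []. Qed.

Lemma normc_ge0 z : 0 <= normc z.
Proof. by rewrite -ler0c -normcE normr_ge0. Qed.

Lemma normc_eq0 z : (normc z == 0) = (z == 0).
Proof.
by apply/eqP/eqP => [/eq0_normc//|->]; rewrite normc0.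
Qed.

Lemma normc_gt0 z : (0 < normc z) = (z != 0).
Proof. by rewrite lt_def normc_eq0 normc_ge0 andbT. Qed.

Lemma normc_le_add z1 z2 : normc (z1 + z2) <= normc z1 + normc z2.
Proof. exact: le_normcD. Qed.

Lemma normc_opp z : normc (- z) = normc z.
Proof. exact: normcN. Qed.

Lemma normc_sub z1 z2 : normc (z1 - z2) = normc (z2 - z1).
Proof. by rewrite -normc_opp opprB. Qed.

Lemma normc_lipschitz z1 z2 : `|normc z1 - normc z2| <= normc (z1 - z2).
Proof.
rewrite ler_norml; apply/andP; split.
  by rewrite lerBrDl addrC -lerBrDl opprK -[z2 in leLHS](subrK z1) addrC normc_sub
    normc_le_add.
by rewrite lerBlDr -[z1 in leLHS](subrK z2) normc_le_add.
Qed.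

Lemma normc_le_sum (I : Type) (r : seq I) (P : pred I) (F : I -> R[i]) :
  normc (\sum_(i <- r | P i) F i) <= \sum_(i <- r | P i) normc (F i).
Proof.
apply: (big_ind2 (fun z x => normc z <= x)) => // [|z1 x1 z2 x2 h1 h2].
  by rewrite normc0.
by rewrite (le_trans (normc_le_add _ _))// lerD.
Qed.

Lemma normc_real (x : R) : normc x%:C = `|x|.
Proof. by rewrite /= expr0n addr0 sqrtr_sqr. Qed.

Lemma normc_conj z : normc z^*%C = normc z.
Proof. by case: z => a b /=; rewrite sqrrN. Qed.

Lemma sqr_normcE z : normc z ^+ 2 = complex.Re z ^+ 2 + complex.Im z ^+ 2.
Proof. by case: z => a b /=; rewrite sqr_sqrtr// addr_ge0// sqr_ge0. Qed.

Lemma mulcJ_normc z : z * z^*%C = (normc z ^+ 2)%:C.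
Proof. by case: z => a b; rewrite sqr_normcE; simpc; rewrite -!expr2 mulrC addNr. Qed.

Lemma Re_le_normc z : `|complex.Re z| <= normc z.
Proof.
rewrite -ler_sqr ?nnegrE ?normc_ge0// real_normK ?num_real// sqr_normcE.
by rewrite lerDl sqr_ge0.
Qed.

Lemma Im_le_normc z : `|complex.Im z| <= normc z.
Proof.
rewrite -ler_sqr ?nnegrE ?normc_ge0// real_normK ?num_real// sqr_normcE.
by rewrite lerDr sqr_ge0.
Qed.

Lemma normc_le_ReIm z : normc z <= `|complex.Re z| + `|complex.Im z|.
Proof.
rewrite -ler_sqr ?nnegrE ?normc_ge0 ?addr_ge0// sqr_normcE sqrrD.
by rewrite !real_normK ?num_real// lerD2r lerDl mulrn_wge0// mulr_ge0.
Qed.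

(** Radii in [R[i]^o] are complex numbers; here they are real, so that all estimates stay in [R]. *)
Definition ccvg {T : Type} (F : set_system T) (f : T -> R[i]) (l : R[i]) :=
  forall e : R, 0 < e -> \forall x \near F, normc (l - f x) < e.

Lemma cvg_normcP {T : Type} {F : set_system T} {FF : Filter F}
    (f : T -> R[i]^o) (l : R[i]) :
  f x @[x --> F] --> (l : R[i]^o) <-> ccvg F f l.
Proof.
split=> [/cvgrPdist_lt + e e0|fl].
  move=> /(_ e%:C); rewrite (ltcR 0) => /(_ e0).
  by apply: filterS => x; rewrite normcE ltcR.
apply/cvgrPdist_lt => e e0.
have eE : e = (complex.Re e)%:C by rewrite RRe_real// gtr0_real.
rewrite eE (ltcR 0) in e0.
move: (fl _ e0); apply: filterS => x.
by rewrite eE (normcE (l - f x)) ltcR.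
Qed.

Lemma ReB z1 z2 : complex.Re (z1 - z2) = complex.Re z1 - complex.Re z2.
Proof. by case: z1 z2 => ? ? []. Qed.

Lemma ImB z1 z2 : complex.Im (z1 - z2) = complex.Im z1 - complex.Im z2.
Proof. by case: z1 z2 => ? ? []. Qed.

Lemma ccvg_lin {T : Type} {F : set_system T} {FF : Filter F}
    (f g : T -> R[i]) (a b c : R[i]) :
  ccvg F f a -> ccvg F g b -> ccvg F (fun x => c * f x + g x) (c * a + b).
Proof.
move=> fa gb e e0.
have c0 : 0 < normc c + 1 by rewrite ltr_wpDl ?normc_ge0.
have e1 : 0 < e / 2 / (normc c + 1) by rewrite !divr_gt0.
have e2 : 0 < e / 2 by rewrite divr_gt0.
move: (fa _ e1) (gb _ e2); apply: filterS2 => x hf hg.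
have -> : c * a + b - (c * f x + g x) = c * (a - f x) + (b - g x) by ring.
rewrite (le_lt_trans (normc_le_add _ _))// (splitr e) ler_ltD// normcM.
rewrite ltr_pdivlMr// in hf; rewrite (le_trans _ (ltW hf))// mulrC.
by rewrite ler_wpM2l ?normc_ge0// lerDl.
Qed.

Lemma ccvg_Re {T : Type} {F : set_system T} {FF : Filter F}
    (f : T -> R[i]) (l : R[i]) :
  ccvg F f l -> complex.Re (f x) @[x --> F] --> complex.Re l.
Proof.
move=> fl; apply/cvgrPdist_lt => e /fl; apply: filterS => x.
by apply: le_lt_trans; rewrite -ReB Re_le_normc.
Qed.

Lemma ccvg_Im {T : Type} {F : set_system T} {FF : Filter F}
    (f : T -> R[i]) (l : R[i]) :
  ccvg F f l -> complex.Im (f x) @[x --> F] --> complex.Im l.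
Proof.
move=> fl; apply/cvgrPdist_lt => e /fl; apply: filterS => x.
by apply: le_lt_trans; rewrite -ImB Im_le_normc.
Qed.

Lemma ccvg_ReIm {T : Type} {F : set_system T} {FF : Filter F}
    (f : T -> R[i]) (l : R[i]) :
  complex.Re (f x) @[x --> F] --> complex.Re l ->
  complex.Im (f x) @[x --> F] --> complex.Im l -> ccvg F f l.
Proof.
move=> /cvgrPdist_lt fa /cvgrPdist_lt fb e e0.
have e2 : 0 < e / 2 by rewrite divr_gt0.
move: (fa _ e2) (fb _ e2); apply: filterS2 => x hx hy.
rewrite (le_lt_trans (normc_le_ReIm _))// (splitr e).
by rewrite ReB ImB ltrD.
Qed.

Lemma ccvg_real {T : Type} {F : set_system T} {FF : Filter F}
    (f : T -> R) (l : R) :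
  f x @[x --> F] --> l -> ccvg F (fun x => (f x)%:C) l%:C.
Proof.
move=> /cvgrPdist_lt fl e /fl; apply: filterS => x.
by rewrite -rmorphB normc_real.
Qed.

Lemma Re_sum (I : Type) (r : seq I) (P : pred I) (F : I -> R[i]) :
  complex.Re (\sum_(i <- r | P i) F i) = \sum_(i <- r | P i) complex.Re (F i).
Proof. by apply: (big_morph _ _ _) => // -[? ?] [? ?]. Qed.

Lemma Im_sum (I : Type) (r : seq I) (P : pred I) (F : I -> R[i]) :
  complex.Im (\sum_(i <- r | P i) F i) = \sum_(i <- r | P i) complex.Im (F i).
Proof. by apply: (big_morph _ _ _) => // -[? ?] [? ?]. Qed.

Lemma real_abs_series_cvg (x : nat -> R) (B : R) :
  (forall n, \sum_(0 <= k < n) `|x k| <= B) -> cvgn (series x).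
Proof.
move=> xB; apply: normed_cvg; apply: nondecreasing_is_cvgn.
  by apply: nondecreasing_series => k _ _; exact: normr_ge0.
by exists B => _ [n _ <-]; exact: xB.
Qed.

(** The modulus dominates real and imaginary parts, so both converge absolutely in [R]; the two
    limits are then reassembled. *)
Lemma cseries_cvg u (B : R) : (forall n, \sum_(0 <= k < n) normc (u k) <= B) ->
  cvgn (series (u : (R[i]^o)^nat)).
Proof.
move=> uB.
have hr : cvgn (series (fun k => complex.Re (u k))).
  apply: (@real_abs_series_cvg _ B) => n; apply: le_trans (uB n).
  by apply: ler_sum => k _; exact: Re_le_normc.
have hi : cvgn (series (fun k => complex.Im (u k))).
  apply: (@real_abs_series_cvg _ B) => n; apply: le_trans (uB n).
  by apply: ler_sum => k _; exact: Im_le_normc.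
set l := limn (series (fun k => complex.Re (u k))) +i*
         limn (series (fun k => complex.Im (u k))).
apply: (@cvgP (R[i]^o) _ (l : R[i]^o)); apply/cvg_normcP/ccvg_ReIm => /=.
  have -> : (fun n => complex.Re (series u n)) = series (fun k => complex.Re (u k)).
    by apply/funext => n; rewrite /series/= Re_sum.
  exact: hr.
have -> : (fun n => complex.Im (series u n)) = series (fun k => complex.Im (u k)).
  by apply/funext => n; rewrite /series/= Im_sum.
exact: hi.
Qed.

Lemma normc_lim_le (v : nat -> R[i]) (l : R[i]) (B : R) :
  ccvg \oo v l -> (\forall n \near \oo, normc (v n) <= B) -> normc l <= B.
Proof.
move=> vl vB; apply/ler_addgt0Pr => e e0.
near \oo => n.
rewrite -(subrK (v n) l) (le_trans (normc_le_add _ _))// addrC lerD//.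
  by near: n.
by apply: ltW; near: n; exact: vl.
Unshelve. all: by end_near. Qed.

(** [dsum] and [A2dot] are instances of [csum] up to conversion, so the lemmas on it serve Dirichlet
    series, inner products and eigenvector expansions alike. *)
Definition csum u : R[i] := limn (series (u : (R[i]^o)^nat)).

Definition asummable u := exists B : R,
  forall n, \sum_(0 <= k < n) normc (u k) <= B.

Lemma csum_cvg u : asummable u ->
  ccvg \oo (fun n => \sum_(0 <= k < n) u k) (csum u).
Proof. by move=> [B uB]; apply/cvg_normcP; exact: cseries_cvg uB. Qed.

Lemma csum_lim u (l : R[i]) :
  ccvg \oo (fun n => \sum_(0 <= k < n) u k) l -> csum u = l.
Proof. by move=> /cvg_normcP ul; apply: (@cvg_lim (R[i]^o)) ul; exact: norm_hausdorff. Qed.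

Lemma normc_csum_le u (B : R) :
  (forall n, \sum_(0 <= k < n) normc (u k) <= B) -> normc (csum u) <= B.
Proof.
move=> uB; apply: (normc_lim_le (@csum_cvg u _)); first by exists B.
apply: nearW => n; rewrite (le_trans _ (uB n))//; exact: normc_le_sum.
Qed.

Lemma asummable_le u (v : nat -> R) (B : R) :
  (forall k, normc (u k) <= v k) -> (forall n, \sum_(0 <= k < n) v k <= B) ->
  forall n, \sum_(0 <= k < n) normc (u k) <= B.
Proof. by move=> uv vB n; rewrite (le_trans _ (vB n))// ler_sum. Qed.

Lemma csum_lin (c : R[i]) u v : asummable u -> asummable v ->
  csum (fun k => c * u k + v k) = c * csum u + csum v.
Proof.
move=> /csum_cvg us /csum_cvg vs; apply: csum_lim.
under eq_fun do rewrite big_split/= -mulr_sumr.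
exact: ccvg_lin.
Qed.

End complex_series.

(** * The weighted l2 space *)

Section weighted_l2.
Context {R : realType} (mu : {measure set (measurableTypeR R) -> \bar R}).
Hypothesis w_gt0 : forall k, 0 < weight mu k.
Implicit Types f g h : nat -> R[i].
Local Notation w := (weight mu).
Local Notation dot := (A2dot mu).
Local Notation nrm := (A2norm mu).

Let w_ge0 k : 0 <= w k. Proof. exact: ltW. Qed.

Lemma A2_term_ge0 f k : 0 <= normc (f k) ^+ 2 * w k.
Proof. by rewrite mulr_ge0 ?sqr_ge0. Qed.

Lemma A2norm2_ge f n :
  ((\sum_(0 <= k < n) normc (f k) ^+ 2 * w k)%:E <= A2norm2 mu f)%E.
Proof.
rewrite -sumEFin; apply: nneseries_lim_ge => k _ _.
by rewrite lee_fin A2_term_ge0.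
Qed.

Lemma A2norm2_le f (B : R) :
  (forall n, \sum_(0 <= k < n) normc (f k) ^+ 2 * w k <= B) ->
  (A2norm2 mu f <= B%:E)%E.
Proof.
move=> fB; apply: lime_le.
  by apply: is_cvg_nneseries => k _ _; rewrite lee_fin A2_term_ge0.
by apply: nearW => n; rewrite sumEFin lee_fin.
Qed.

Lemma A2norm2_ge0 f : (0 <= A2norm2 mu f)%E.
Proof. by apply: le_trans (A2norm2_ge f 0); rewrite big_geq. Qed.

Lemma A2_bounded f (B : R) :
  (forall n, \sum_(0 <= k < n) normc (f k) ^+ 2 * w k <= B) -> A2 mu f.
Proof. by move=> /A2norm2_le fB; rewrite /A2/= (le_lt_trans fB)// ltry. Qed.

Lemma A2norm_ge0 f : 0 <= nrm f. Proof. exact: sqrtr_ge0. Qed.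

Lemma sqr_A2norm f : nrm f ^+ 2 = fine (A2norm2 mu f).
Proof. by rewrite sqr_sqrtr// fine_ge0// A2norm2_ge0. Qed.

Lemma A2norm_le f (B : R) :
  (forall n, \sum_(0 <= k < n) normc (f k) ^+ 2 * w k <= B) -> nrm f ^+ 2 <= B.
Proof.
move=> fB; rewrite sqr_A2norm -lee_fin fineK ?A2norm2_le//.
by rewrite ge0_fin_numE ?A2norm2_ge0//; exact: A2_bounded fB.
Qed.

Lemma A2norm_ge f n : A2 mu f ->
  \sum_(0 <= k < n) normc (f k) ^+ 2 * w k <= nrm f ^+ 2.
Proof.
move=> fA; rewrite sqr_A2norm -lee_fin fineK ?A2norm2_ge//.
by rewrite ge0_fin_numE ?A2norm2_ge0.
Qed.

(** Termwise, |c f + g|^2 <= 2 |c|^2 |f|^2 + 2 |g|^2. *)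
Lemma A2_lin (c : R[i]) f g : A2 mu f -> A2 mu g ->
  A2 mu (fun k => c * f k + g k).
Proof.
move=> fA gA.
apply: (@A2_bounded _ (2 * normc c ^+ 2 * nrm f ^+ 2 + 2 * nrm g ^+ 2)) => n.
apply: (@le_trans _ _ (2 * normc c ^+ 2 * (\sum_(0 <= k < n) normc (f k) ^+ 2 * w k)
   + 2 * \sum_(0 <= k < n) normc (g k) ^+ 2 * w k)); last first.
  by apply: lerD; rewrite ler_wpM2l ?A2norm_ge// mulr_ge0// sqr_ge0.
rewrite !mulr_sumr -big_split/=; apply: ler_sum => k _.
rewrite !mulrA -mulrDl ler_wpM2r//.
have h1 : normc (c * f k + g k) <= normc c * normc (f k) + normc (g k).
  by rewrite (le_trans (normc_le_add _ _))// normcM.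
have := normc_ge0 (c * f k + g k).
have : 0 <= (normc c * normc (f k) - normc (g k)) ^+ 2 by exact: sqr_ge0.
move=> ? ?; have : normc (c * f k + g k) ^+ 2 <= (normc c * normc (f k) + normc (g k)) ^+ 2.
  by rewrite ler_sqr ?nnegrE// (le_trans _ h1).
by move=> h2; nra.
Qed.

Lemma A2_0 : A2 mu (fun=> 0).
Proof.
apply: (@A2_bounded _ 0) => n; rewrite big1// => k _.
by rewrite normc0 expr0n mul0r.
Qed.

Lemma A2dot_sum_le f g (t : R) n : 0 < t -> A2 mu f -> A2 mu g ->
  \sum_(0 <= k < n) normc (f k * (g k)^*%C * (w k)%:C) <=
    (t * nrm f ^+ 2 + t^-1 * nrm g ^+ 2) / 2.
Proof.
move=> t0 fA gA.
apply: (@le_trans _ _ ((t * (\sum_(0 <= k < n) normc (f k) ^+ 2 * w k)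
   + t^-1 * \sum_(0 <= k < n) normc (g k) ^+ 2 * w k) / 2)); last first.
  by rewrite ler_pM2r ?invr_gt0// lerD// ler_wpM2l ?A2norm_ge// ltW// invr_gt0.
rewrite !mulr_sumr -big_split/= mulr_suml; apply: ler_sum => k _.
rewrite !normcM normc_conj normc_real (ger0_norm (w_ge0 k)).
rewrite [leRHS](_ : _ = (t * normc (f k) ^+ 2 + t^-1 * normc (g k) ^+ 2) / 2 * w k); last by ring.
rewrite ler_wpM2r// -subr_ge0.
rewrite [leRHS](_ : _ = t^-1 / 2 * (t * normc (f k) - normc (g k)) ^+ 2).
  by rewrite mulr_ge0 ?sqr_ge0// mulr_ge0// ltW// invr_gt0.
by field; rewrite gt_eqF.
Qed.

Lemma A2dot_cvg f g : A2 mu f -> A2 mu g ->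
  ccvg \oo (fun n => \sum_(0 <= k < n) f k * (g k)^*%C * (w k)%:C) (dot f g).
Proof.
move=> fA gA; apply: csum_cvg; eexists => n.
exact: A2dot_sum_le ltr01 fA gA.
Qed.

Lemma A2dot_lim f g (l : R[i]) :
  ccvg \oo (fun n => \sum_(0 <= k < n) f k * (g k)^*%C * (w k)%:C) l ->
  dot f g = l.
Proof. exact: csum_lim. Qed.

(* The factor [t] is free: Cauchy-Schwarz is only used in this AM-GM form. *)
Lemma A2dot_le f g (t : R) : 0 < t -> A2 mu f -> A2 mu g ->
  normc (dot f g) <= (t * nrm f ^+ 2 + t^-1 * nrm g ^+ 2) / 2.
Proof.
by move=> t0 fA gA; apply: normc_csum_le => n; exact: A2dot_sum_le.
Qed.

Lemma A2dot_linl (c : R[i]) f g h : A2 mu f -> A2 mu g -> A2 mu h ->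
  dot (fun k => c * f k + g k) h = c * dot f h + dot g h.
Proof.
move=> fA gA hA; apply: A2dot_lim.
rewrite [X in ccvg _ X](_ : _ = fun n =>
   c * (\sum_(0 <= k < n) f k * (h k)^*%C * (w k)%:C)
   + \sum_(0 <= k < n) g k * (h k)^*%C * (w k)%:C); last first.
  apply/funext => n; rewrite mulr_sumr -big_split/=.
  by apply: eq_bigr => k _; rewrite !mulrDl !mulrA.
by apply: ccvg_lin; exact: A2dot_cvg.
Qed.

Lemma A2dotC f g : A2 mu f -> A2 mu g -> dot g f = (dot f g)^*%C.
Proof.
move=> fA gA; apply: A2dot_lim.
have hc := A2dot_cvg fA gA => e /hc.
apply: filterS => n.
have -> : \sum_(0 <= k < n) g k * (f k)^*%C * (w k)%:C =
    (\sum_(0 <= k < n) f k * (g k)^*%C * (w k)%:C)^*%C.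
  rewrite rmorph_sum; apply: eq_bigr => k _.
  rewrite !rmorphM /= conjcK oppr0; congr (_ * _); exact: mulrC.
by rewrite -rmorphB normc_conj.
Qed.

Lemma A2dot_linr (c : R[i]) f g h : A2 mu f -> A2 mu g -> A2 mu h ->
  dot h (fun k => c * f k + g k) = c^*%C * dot h f + dot h g.
Proof.
move=> fA gA hA; rewrite (A2dotC (A2_lin c fA gA) hA) A2dot_linl// rmorphD.
by rewrite rmorphM /= -(A2dotC fA hA) -(A2dotC gA hA).
Qed.

Lemma A2dot_norm f : A2 mu f -> dot f f = (nrm f ^+ 2)%:C.
Proof.
move=> fA; apply: A2dot_lim.
rewrite [X in ccvg _ X](_ : _ = fun n =>
   (\sum_(0 <= k < n) normc (f k) ^+ 2 * w k)%:C); last first.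
  apply/funext => n; rewrite rmorph_sum; apply: eq_bigr => k _.
  by rewrite mulcJ_normc -rmorphM.
apply: ccvg_real.
have /fine_cvg : (\sum_(0 <= k < n) normc (f k) ^+ 2 * w k)%:E @[n --> \oo] -->
    (nrm f ^+ 2)%:E; last exact.
rewrite sqr_A2norm fineK; last by rewrite ge0_fin_numE ?A2norm2_ge0.
under eq_fun do rewrite -sumEFin.
by apply: is_cvg_nneseries => k _ _; rewrite lee_fin A2_term_ge0.
Qed.

End weighted_l2.

(** * Finite combinations of a sequence of vectors and Bessel's inequality *)

Section orthonormal_sequences.
Context {R : realType} (mu : {measure set (measurableTypeR R) -> \bar R}).
Hypothesis w_gt0 : forall k, 0 < weight mu k.
Implicit Types (f g h : nat -> R[i]) (r : seq nat).
Local Notation w := (weight mu).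
Local Notation dot := (A2dot mu).
Local Notation nrm := (A2norm mu).

Context (e : nat -> nat -> R[i]).
Hypothesis eA : forall n, A2 mu (e n).

(** The index list is arbitrary in order to cover initial segments and tails alike. The family may
    also be [T (e n)], which need not be orthonormal. *)
Definition lincomb (a : nat -> R[i]) r : nat -> R[i] :=
  fun k => \sum_(n <- r) a n * e n k.

Lemma lincomb_cons a n r :
  lincomb a (n :: r) = fun k => a n * e n k + lincomb a r k.
Proof. by apply/funext => k; rewrite /lincomb big_cons. Qed.

Lemma lincomb_nil a : lincomb a [::] = fun=> 0.
Proof. by apply/funext => k; rewrite /lincomb big_nil. Qed.

Lemma A2_lincomb a r : A2 mu (lincomb a r).
Proof.
elim: r => [|n r ih]; first by rewrite lincomb_nil; exact: A2_0.
by rewrite lincomb_cons; exact: A2_lin.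
Qed.

Lemma A2dot0l h : dot (fun=> 0) h = 0.
Proof.
apply: A2dot_lim => ep ep0; apply: nearW => n.
by rewrite big1 ?subrr ?normc0// => k _; rewrite !mul0r.
Qed.

Lemma A2dot_lincombl a r h : A2 mu h ->
  dot (lincomb a r) h = \sum_(n <- r) a n * dot (e n) h.
Proof.
move=> hA; elim: r => [|n r ih]; first by rewrite lincomb_nil big_nil A2dot0l.
by rewrite lincomb_cons big_cons A2dot_linl// ?ih//; exact: A2_lincomb.
Qed.

Lemma A2dot_lincombr a r h : A2 mu h ->
  dot h (lincomb a r) = \sum_(n <- r) (a n)^*%C * dot h (e n).
Proof.
move=> hA; rewrite (A2dotC w_gt0 (A2_lincomb a r) hA) A2dot_lincombl// rmorph_sum.
by apply: eq_bigr => n _; rewrite rmorphM /= -(A2dotC w_gt0 (eA n) hA).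
Qed.

Hypothesis e_on : A2orthonormal mu e.

Let eO m n : dot (e m) (e n) = (m == n)%:R. Proof. by case: e_on. Qed.

Lemma A2dot_lincomb_e a r m : uniq r -> m \in r -> dot (lincomb a r) (e m) = a m.
Proof.
move=> ur mr; rewrite A2dot_lincombl// (bigD1_seq m)//= eO eqxx mulr1.
by rewrite big1 ?addr0// => n /negbTE nm; rewrite eO nm mulr0.
Qed.

Lemma sqr_A2norm_lincomb a r : uniq r ->
  nrm (lincomb a r) ^+ 2 = \sum_(n <- r) normc (a n) ^+ 2.
Proof.
move=> ur; have lA := A2_lincomb a r.
apply: (@complexI R); rewrite -(A2dot_norm w_gt0 lA) A2dot_lincombr// rmorph_sum.
rewrite !big_seq; apply: eq_bigr => n nr /=.
by rewrite A2dot_lincomb_e// mulrC mulcJ_normc.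
Qed.

(** The vector [v] is, up to the order of the terms, f minus its projection onto the span of the
    [e n] with n in [r]. It is orthogonal to that span, and its squared norm is the difference of
    the two sides. *)
Lemma bessel f r : A2 mu f -> uniq r ->
  \sum_(n <- r) normc (dot f (e n)) ^+ 2 <= nrm f ^+ 2.
Proof.
move=> fA ur; set c := fun n => dot f (e n).
have uA := A2_lincomb c r.
have vA := A2_lin w_gt0 (-1) uA fA.
set v := (fun k => _) in vA.
have vO n : n \in r -> dot v (e n) = 0.
  by move=> nr; rewrite A2dot_linl// A2dot_lincomb_e// mulN1r addNr.
have : dot v v = (nrm f ^+ 2 - \sum_(n <- r) normc (c n) ^+ 2)%:C.
  rewrite {1}/v A2dot_linl// (A2dotC w_gt0 vA uA) A2dot_lincombr// big_seq big1.
    rewrite rmorph0 mulr0 add0r A2dot_linr// A2dot_lincombr// A2dot_norm//.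
    rewrite rmorphN1 mulN1r addrC rmorphB; congr (_ - _).
    by rewrite rmorph_sum; apply: eq_bigr => n _; rewrite mulrC mulcJ_normc.
  by move=> n nr; rewrite vO// mulr0.
rewrite A2dot_norm// => /complexI; rewrite -subr_ge0 => <-; exact: sqr_ge0.
Qed.

End orthonormal_sequences.

(** * Expansion along the singular vectors and the resulting bound on T f *)

Lemma nneg_sum_tail {R : realType} (x : nat -> R) (B ep : R) :
  (forall k, 0 <= x k) -> (forall n, \sum_(0 <= k < n) x k <= B) -> 0 < ep ->
  exists N, forall n, \sum_(N <= k < n) x k <= ep.
Proof.
move=> x0 xB ep0.
have nd : nondecreasing_seq (series x) by apply: nondecreasing_series => k _ _.
have cx : cvgn (series x).
  by apply: nondecreasing_is_cvgn nd _; exists B => _ [n _ <-]; exact: xB.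
have /cvgrPdist_lt/(_ _ ep0)[N _ hN] := cx; exists N => n.
have := hN N (leqnn N) => /=.
have [nN|/ltnW Nn] := leqP n N; first by rewrite big_geq// ltW.
have := nondecreasing_cvgn_le nd cx n.
rewrite /series/= (big_cat_nat (leq0n N) Nn)//= => h1 /ltW/ler_normlW h2; lra.
Qed.

Lemma cvg_sum_nat {R : realType} {T : Type} {F : set_system T} {FF : Filter F}
    (f : nat -> T -> R) (l : nat -> R) (M : nat) :
  (forall k, f k x @[x --> F] --> l k) ->
  \sum_(0 <= k < M) f k x @[x --> F] --> \sum_(0 <= k < M) l k.
Proof.
move=> fl; elim: M => [|M ih].
  by rewrite big_geq//; under eq_fun do rewrite big_geq//; exact: cvg_cst.
rewrite big_nat_recr//=; under eq_fun do rewrite big_nat_recr//=.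
exact: cvgD.
Qed.

Lemma ccvg_normcB {R : realType} {T : Type} {F : set_system T} {FF : Filter F}
    (f : T -> R[i]) (l z : R[i]) :
  ccvg F f l -> normc (f x - z) @[x --> F] --> normc (l - z).
Proof.
move=> fl; apply/cvgrPdist_lt => e /fl; apply: filterS => x.
apply: le_lt_trans; rewrite (le_trans (normc_lipschitz _ _))//.
by rewrite opprB addrA subrK.
Qed.

Section singular_value_bound.
Context {R : realType} (mu : {measure set (measurableTypeR R) -> \bar R}).
Hypothesis w_gt0 : forall k, 0 < weight mu k.
Implicit Types (f g h : nat -> R[i]).
Local Notation w := (weight mu).
Local Notation dot := (A2dot mu).
Local Notation nrm := (A2norm mu).

(** The series (m + 1)^(-s), which is sqrt(w_{m+1}) b_m in the notation of the overview. Leaving it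
    unnormalised avoids square roots of weights. *)
Definition monomial (m : nat) : nat -> R[i] := fun k => (k == m)%:R.

Lemma sum_monomial (F : nat -> R) m n : (forall k, k != m -> F k = 0) ->
  \sum_(0 <= k < n) F k = if (m < n)%N then F m else 0.
Proof.
move=> F0; case: ifPn => mn.
  rewrite (bigD1_seq m) ?iota_uniq ?mem_index_iota//= big1 ?addr0//.
rewrite big_seq big1// => k; rewrite mem_index_iota => /andP[_ kn].
by apply: F0; apply: contra mn => /eqP <-.
Qed.

Lemma A2_monomial m : A2 mu (monomial m) /\ nrm (monomial m) ^+ 2 = w m.
Proof.
have w0 k : 0 <= w k by exact: ltW.
have sE n : \sum_(0 <= k < n) normc (monomial m k) ^+ 2 * w k =
    if (m < n)%N then w m else 0.
  rewrite (@sum_monomial _ m) /monomial ?eqxx ?normc1 ?expr1n ?mul1r// => k /negbTE ->.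
  by rewrite normc0 expr0n mul0r.
have sB n : \sum_(0 <= k < n) normc (monomial m k) ^+ 2 * w k <= w m.
  by rewrite sE; case: ifP.
have mA := A2_bounded w_gt0 sB.
split=> //; apply/eqP; rewrite eq_le A2norm_le//=.
by have := A2norm_ge w_gt0 m.+1 mA; rewrite sE ltnSn.
Qed.

Lemma A2dot_monomial m g : dot (monomial m) g = (g m)^*%C * (w m)%:C.
Proof.
apply: A2dot_lim => ep ep0; near=> n.
rewrite (bigD1_seq m) ?iota_uniq ?mem_index_iota//=; last by near: n; exact: nbhs_infty_gt.
rewrite big1 /monomial => [|k /negbTE ->]; last by rewrite !mul0r.
by rewrite eqxx mul1r addr0 subrr normc0.
Unshelve. all: by end_near. Qed.

Context (e : nat -> nat -> R[i]).
Hypothesis e_on : A2orthonormal mu e.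
Let eA n : A2 mu (e n). Proof. by case: e_on. Qed.

(** Bessel's inequality for the monomial of index k, whose inner product with [e i] has modulus
    |e_i(k)| w_k and whose squared norm is w_k. *)
Lemma orthonormal_coord_le k n :
  \sum_(0 <= i < n) normc (e i k) ^+ 2 <= (w k)^-1.
Proof.
have [mA mN] := A2_monomial k.
have := bessel w_gt0 eA e_on mA (iota_uniq 0 n).
rewrite mN => bE.
have : (\sum_(0 <= i < n) normc (e i k) ^+ 2) * w k ^+ 2 <= w k.
  apply: le_trans bE; rewrite mulr_suml /index_iota subn0; apply: ler_sum => i _.
  by rewrite A2dot_monomial normcM normc_conj normc_real exprMn real_normK ?num_real.
by rewrite expr2 mulrA -[leRHS]mul1r ler_pM2r// -ler_pdivlMr// div1r.
Qed.

Section expansion.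
Variables (f : nat -> R[i]) (fA : A2 mu f).
Let c n := dot f (e n).
(** The orthogonal projection of f onto the closed span of the [e n], built one Dirichlet
    coefficient at a time so that only limits in [R[i]] are taken. *)
Let u k := csum (fun n => c n * e n k).

Lemma coef_sum_le n : \sum_(0 <= i < n) normc (c i) ^+ 2 <= nrm f ^+ 2.
Proof. by apply: (bessel w_gt0 eA e_on fA); exact: iota_uniq. Qed.

(** |c_n e_n(k)| <= (|c_n|^2 + |e_n(k)|^2) / 2, and both squares are summable over n by Bessel's
    inequality, for f and for the monomial of index k. *)
Lemma expansion_cvg k :
  ccvg \oo (fun n => lincomb e c (index_iota 0 n) k) (u k).
Proof.
apply: csum_cvg; exists ((nrm f ^+ 2 + (w k)^-1) / 2) => n.
apply: (@le_trans _ _ ((\sum_(0 <= i < n) normc (c i) ^+ 2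
    + \sum_(0 <= i < n) normc (e i k) ^+ 2) / 2)); last first.
  by rewrite ler_pM2r ?invr_gt0// lerD ?coef_sum_le ?orthonormal_coord_le.
rewrite -big_split/= mulr_suml; apply: ler_sum => i _; rewrite normcM.
have := sqr_ge0 (normc (c i) - normc (e i k)); nra.
Qed.

(** A Fatou argument: on the first M coordinates the finite sums from N to n have squared norm at
    most [tau] for every n, and the bound survives n -> oo. *)
Lemma expansion_tail N (tau : R) :
  (forall n, \sum_(N <= i < n) normc (c i) ^+ 2 <= tau) ->
  forall n, \sum_(0 <= k < n)
    normc (u k - lincomb e c (index_iota 0 N) k) ^+ 2 * w k <= tau.
Proof.
move=> tauP M.
have cvgS : \sum_(0 <= k < M) normc (lincomb e c (index_iota 0 n) k -
      lincomb e c (index_iota 0 N) k) ^+ 2 * w k @[n --> \oo] -->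
    \sum_(0 <= k < M) normc (u k - lincomb e c (index_iota 0 N) k) ^+ 2 * w k.
  apply: cvg_sum_nat => k; apply: cvgMr_tmp; rewrite expr2.
  under eq_fun do rewrite expr2.
  by apply: cvgM; apply: ccvg_normcB; exact: expansion_cvg.
rewrite -(cvg_lim (@Rhausdorff R) cvgS); apply: limr_le; first exact: cvgP cvgS.
near=> n.
have Nn : (N <= n)%N by near: n; exact: nbhs_infty_ge.
have lE k : lincomb e c (index_iota 0 n) k - lincomb e c (index_iota 0 N) k =
    lincomb e c (index_iota N n) k.
  by rewrite /lincomb (big_cat_nat (leq0n N) Nn)//= addrAC subrr add0r.
under eq_bigr do rewrite lE.
rewrite (le_trans (A2norm_ge w_gt0 M (A2_lincomb w_gt0 eA c (index_iota N n))))//.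
by rewrite sqr_A2norm_lincomb// iota_uniq.
Unshelve. all: by end_near. Qed.

(** The remainder is written in the shape c f + g of [A2linear], ready for the linearity of T and of
    the inner product. *)
Lemma A2_expansion_tail N (tau : R) :
  (forall n, \sum_(N <= i < n) normc (c i) ^+ 2 <= tau) ->
  let v k := (-1) * lincomb e c (index_iota 0 N) k + u k in
  A2 mu v /\ nrm v ^+ 2 <= tau.
Proof.
move=> /expansion_tail tauP v.
have vB n : \sum_(0 <= k < n) normc (v k) ^+ 2 * w k <= tau.
  rewrite (le_trans _ (tauP n))// le_eqVlt; apply/orP; left; apply/eqP.
  by apply: eq_bigr => k _; rewrite /v mulN1r addrC.
by split; [exact: A2_bounded vB|exact: A2norm_le].
Qed.

Lemma A2_expansion : A2 mu u.
Proof.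
have [] := @A2_expansion_tail 0 (nrm f ^+ 2) coef_sum_le.
rewrite /index_iota/= lincomb_nil.
by under eq_fun do rewrite mulr0 add0r.
Qed.

Lemma expansion_coef n : dot u (e n) = c n.
Proof.
apply/eqP; rewrite -subr_eq0 -normc_eq0 eq_le normc_ge0 andbT.
apply/ler_addgt0Pr => ep ep0; rewrite add0r.
have [N0 tailN] := nneg_sum_tail (fun k => sqr_ge0 (normc (c k))) coef_sum_le (exprn_gt0 2 ep0).
(* N > n, so that [e n] occurs in the partial sum and contributes the coefficient [c n]. *)
set N := maxn N0 n.+1.
have /A2_expansion_tail[vA vN] m : \sum_(N <= i < m) normc (c i) ^+ 2 <= ep ^+ 2.
  have [mN|Nm] := leqP m N; first by rewrite big_geq// sqr_ge0.
  rewrite (le_trans _ (tailN m))// [leRHS](big_cat_nat (leq_maxl N0 n.+1) (ltnW Nm))/=.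
  by rewrite lerDr sumr_ge0// => i _; exact: sqr_ge0.
(* With t = 1 / ep, |v| <= ep and |e_n| = 1 the right-hand side is at most (ep + ep) / 2. *)
have := A2dot_le w_gt0 (_ : 0 < ep^-1) vA (eA n).
rewrite invr_gt0 => /(_ ep0).
have uA := A2_expansion.
rewrite A2dot_linl//; last exact: A2_lincomb.
rewrite A2dot_lincomb_e ?iota_uniq ?mem_index_iota ?leq_maxr// mulN1r addrC.
move=> /le_trans; apply.
have /complexI -> : (nrm (e n) ^+ 2)%:C = 1%:C.
  by rewrite -A2dot_norm//; case: e_on => _ ->; rewrite eqxx.
rewrite invrK mulr1 ler_pdivrMr// mulrDr mulr1 lerD2r.
by rewrite ler_pdivrMl// -expr2.
Qed.

End expansion.

Context (T Tstar : (nat -> R[i]) -> nat -> R[i]) (s : nat -> R).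
Hypotheses (T_lin : A2linear mu T) (T_bd : A2bounded mu T)
  (T_adj : A2adjoint mu T Tstar)
  (s_ge0 : forall n, 0 <= s n) (s_noninc : nonincreasing_seq s)
  (T_eig : forall n, Tstar (T (e n)) = (fun k => ((s n) ^+ 2)%:C * e n k))
  (T_exh : forall f, A2 mu f -> (forall n, dot f (e n) = 0) -> T f = fun=> 0).

Lemma A2_T f : A2 mu f -> A2 mu (T f).
Proof. by case: T_bd => M TM /TM[]. Qed.

Lemma A2dot_T_e f n : A2 mu f ->
  dot (T f) (T (e n)) = (s n ^+ 2)%:C * dot f (e n).
Proof.
move=> fA; rewrite T_adj.2//; last exact: A2_T.
have A0 : A2 mu (fun=> 0) by exact: A2_0.
have -> : Tstar (T (e n)) = (fun k => ((s n) ^+ 2)%:C * e n k + 0).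
  by rewrite T_eig; apply/funext => k; rewrite addr0.
rewrite (A2dot_linr w_gt0 _ (eA n) A0 fA) (A2dotC w_gt0 A0 fA) A2dot0l//.
by rewrite rmorph0 addr0 /= oppr0.
Qed.

Lemma T_lincomb a r : T (lincomb e a r) = lincomb (fun n => T (e n)) a r.
Proof.
elim: r => [|n r ih].
  rewrite !lincomb_nil; have A0 : A2 mu (fun=> 0) by exact: A2_0.
  (* [A2linear] only speaks of combinations c f + g; T 0 = 0 is read off from T 0 = T 0 + T 0. *)
  have := T_lin 1 A0 A0.
  rewrite [X in T X = _](_ : _ = fun=> 0); last by apply/funext => k; rewrite mul1r addr0.
  move=> TE; apply/funext => k; have /eqP := congr1 (@^~ k) TE.
  by rewrite mul1r -subr_eq0 opprD addrA subrr add0r oppr_eq0 => /eqP.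
by rewrite !lincomb_cons (T_lin _ (eA n) (A2_lincomb w_gt0 eA a r)) ih.
Qed.

(** Split at K: s_n <= s_0 before K and s_n <= s_K from K on. It is applied to x_n = |<f, e_n>|^2
    and B = |f|^2. *)
Lemma singular_sum_le (x : nat -> R) (B : R) K N : (forall n, 0 <= x n) ->
  (forall n, \sum_(0 <= i < n) x i <= B) ->
  \sum_(0 <= n < N) s n ^+ 2 * x n <=
    s 0 ^+ 2 * (\sum_(0 <= n < K) x n) + s K ^+ 2 * B.
Proof.
move=> x0 xB; have B0 : 0 <= B by have := xB 0; rewrite big_geq.
have sq m n : (m <= n)%N -> s n ^+ 2 <= s m ^+ 2.
  by move=> mn; rewrite ler_sqr ?nnegrE// s_noninc.
have [NK|/ltnW KN] := leqP N K.
  rewrite ler_wpDr ?mulr_ge0 ?sqr_ge0// mulr_sumr (big_cat_nat (leq0n N) NK)/=.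
  rewrite ler_wpDr//; first by apply: sumr_ge0 => i _; rewrite mulr_ge0 ?sqr_ge0.
  by apply: ler_sum => i _; rewrite ler_wpM2r ?sq.
rewrite (big_cat_nat (leq0n K) KN)/=; apply: lerD.
  by rewrite mulr_sumr; apply: ler_sum => i _; rewrite ler_wpM2r ?sq.
apply: (@le_trans _ _ (s K ^+ 2 * \sum_(K <= i < N) x i)).
  rewrite mulr_sumr big_seq [leRHS]big_seq; apply: ler_sum => i.
  by rewrite mem_index_iota => /andP[Ki _]; rewrite ler_wpM2r ?sq.
rewrite ler_wpM2l ?sqr_ge0// (le_trans _ (xB N))// (big_cat_nat (leq0n K) KN)/=.
by rewrite lerDr sumr_ge0.
Qed.

(** By the eigenvector equation <T f, T e_n> = s_n^2 <f, e_n>, so pairing T f with T applied to a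
    partial sum of the expansion produces the sum of s_n^2 |<f, e_n>|^2. The remainder [v] is small
    and T is bounded, so the pairing with [T v] costs at most [eta]. *)
Lemma sqr_A2norm_T_le f K : A2 mu f ->
  nrm (T f) ^+ 2 <= s 0 ^+ 2 * (\sum_(0 <= n < K) normc (dot f (e n)) ^+ 2)
                  + s K ^+ 2 * nrm f ^+ 2.
Proof.
move=> fA; have TfA := A2_T fA.
pose c n := dot f (e n); pose u k := csum (fun n => c n * e n k).
have uA : A2 mu u := A2_expansion fA.
set Q := leRHS.
have QP N : \sum_(0 <= n < N) s n ^+ 2 * normc (c n) ^+ 2 <= Q.
  by apply: singular_sum_le => [n|n]; [exact: sqr_ge0|exact: coef_sum_le].
(* f - u is orthogonal to every [e n], hence T vanishes on it because the eigenvectors exhaust the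
   complement of the kernel. *)
have TfE : T f = T u.
  have := T_lin (-1) uA fA; rewrite T_exh.
  - move=> TE; apply/funext => k; have /eqP := congr1 (@^~ k) TE.
    by rewrite mulN1r addrC eq_sym subr_eq0 => /eqP.
  - exact: A2_lin.
  - by move=> n; rewrite A2dot_linl// expansion_coef// mulN1r addNr.
apply/ler_addgt0Pr => eta eta0.
pose D := nrm (T f) ^+ 2 + 1.
have D0 : 0 < D by rewrite ltr_wpDl ?sqr_ge0.
(* Chosen so that (ep |T f|^2 + ep) / 2 = eta, the error left by [A2dot_le] with t = ep once |T v|
   <= ep. *)
pose ep := 2 * eta / D.
have ep0 : 0 < ep by rewrite divr_gt0// mulr_gt0.
have [M TM] := T_bd.
have M0 : 0 < M ^+ 2 + 1 by rewrite ltr_wpDl ?sqr_ge0.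
(* The tail is at most ep^2 / (M^2 + 1), so that M |v| <= ep; the added 1 covers M = 0. *)
have [N tailN] := nneg_sum_tail (fun k => sqr_ge0 (normc (c k)))
  (coef_sum_le fA) (divr_gt0 (exprn_gt0 2 ep0) M0).
have [] := A2_expansion_tail fA tailN.
set v := (fun k => _) => vA vN.
have lA := A2_lincomb w_gt0 eA c (index_iota 0 N).
have TvN : nrm (T v) ^+ 2 <= ep ^+ 2.
  apply: (@le_trans _ _ ((M * nrm v) ^+ 2)).
    rewrite ler_sqr ?nnegrE ?A2norm_ge0 ?(TM _ vA).2//.
    exact: le_trans (A2norm_ge0 _ _) (TM _ vA).2.
  rewrite exprMn (le_trans (ler_wpM2l (sqr_ge0 M) vN))//.
  rewrite mulrA ler_pdivrMr// mulrC ler_wpM2l ?sqr_ge0//.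
  by rewrite lerDl.
have TvE : dot (T f) (T v) = (nrm (T f) ^+ 2)%:C -
    (\sum_(0 <= n < N) s n ^+ 2 * normc (c n) ^+ 2)%:C.
  rewrite T_lin// A2dot_linr// -?TfE//; last exact: A2_T.
  rewrite A2dot_norm// T_lincomb rmorphN1 mulN1r addrC; congr (_ - _).
  rewrite A2dot_lincombr//; last by move=> n; exact: A2_T.
  rewrite rmorph_sum; apply: eq_bigr => n _.
  by rewrite A2dot_T_e// mulrCA [_^*%C * _]mulrC mulcJ_normc -rmorphM.
have := A2dot_le w_gt0 ep0 TfA (A2_T vA).
rewrite TvE -rmorphB normc_real => /ler_normlW h1.
have h2 : ep^-1 * nrm (T v) ^+ 2 <= ep by rewrite ler_pdivrMl// -expr2.
have h3 := QP N.
have h4 : ep * nrm (T f) ^+ 2 + ep = 2 * eta.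
  by rewrite -[X in _ + X]mulr1 -mulrDr /ep divfK// gt_eqF.
rewrite -[leLHS]/(nrm (T f) ^+ 2); move: h1 h2 h3 h4.
set a := nrm (T f) ^+ 2; set b := \sum_(0 <= n < N) _.
set y := _ * nrm (T v) ^+ 2 => h1 h2 h3 h4; lra.
Qed.

End singular_value_bound.

(** * Supermultiplicativity of the weights *)

Section laplace_weights.
Context {R : realType} (mu : probability (measurableTypeR R) R).
Hypothesis mu_pos : mu `]0, +oo[%classic = 1%E.
Local Notation D := (`]0, +oo[%classic : set (measurableTypeR R)).

(** The Laplace transform of [mu] at 2 L. At L = ln n, products of integers become sums of
    arguments. *)
Let phi (L : R) : R := \int[mu]_(x in D) expR (- (2 * x * L)).

Lemma weightE k : weight mu k = phi (ln k.+1%:R).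
Proof.
rewrite /weight /phi; congr (fine _); apply: eq_integral => x _.
by rewrite /powR gt_eqF// mulNr.
Qed.

Let mD : measurable D. Proof. exact: measurable_itv. Qed.

Let int_cst (r : R) : \int[mu]_(x in D) r = r.
Proof. by rewrite Rintegral_cst// [X in fine X]mu_pos mulr1. Qed.

Let mexp (L : R) : measurable_fun D (fun x => expR (- (2 * x * L))).
Proof.
apply: measurable_funTS; apply: measurableT_comp; first exact: measurable_expR.
apply: measurable_funN; apply: measurable_funM => //; exact: measurable_funM. 
Qed.

Let iexp (L : R) : 0 <= L -> mu.-integrable D (EFin \o (fun x => expR (- (2 * x * L)))).
Proof.
move=> L0; apply: measurable_bounded_integrable => //.
  by rewrite (le_lt_trans (probability_le1 mu mD))// ltry.
exists 1; split; first exact: num_real.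
move=> r r1 x /=; rewrite in_itv/= andbT => x0.
rewrite ger0_norm ?expR_ge0// (le_trans _ (ltW r1))// -expR0 ler_expR oppr_le0.
by rewrite !mulr_ge0// ltW.
Qed.

Let icst (r : R) : mu.-integrable D (EFin \o (fun=> r)).
Proof.
have := integrableZl mD r (iexp (lexx 0)).
by apply: eq_integrable => // x _; rewrite /= mulr0 oppr0 expR0 mule1.
Qed.

(** A zero integral would force the positive integrand to vanish almost everywhere on [D], making
    [D] a null set. *)
Let phi_gt0 L : 0 <= L -> 0 < phi L.
Proof.
move=> L0; rewrite lt_def Rintegral_ge0 ?andbT; last by move=> x _; exact: expR_ge0.
apply/eqP => phi0.
have : (\int[mu]_(x in D) `|(expR (- (2 * x * L)))%:E|)%E = 0%E.
  rewrite (eq_integral (fun x : measurableTypeR R => (expR (- (2 * (x : R) * L)))%:E)); last first.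
    by move=> x _; rewrite /= ger0_norm// expR_ge0.
  rewrite -[LHS]fineK; first by rewrite -/(Rintegral _ _ _) -/(phi L) phi0.
  exact: integrable_fin_num (iexp L0).
have /measurable_EFinP/(ae_eq_integral_abs mu mD)[+ _] := mexp L.
move=> /[apply]; case.
move=> N [mN N0 DN].
have : (mu D <= mu N)%E.
  apply: le_measure; rewrite ?inE// => x Dx; apply: DN => /= /(_ Dx) [] /eqP.
  by rewrite gt_eqF// expR_gt0.
by rewrite mu_pos N0 lee_fin ler10.
Qed.

Let phi_le1 L : 0 <= L -> phi L <= 1.
Proof.
move=> L0; have -> : 1 = \int[mu]_(x in D) 1 by rewrite int_cst.
apply: le_Rintegral => //; first exact: iexp.
move=> x /=; rewrite in_itv/= andbT => x0; rewrite -expR0 ler_expR oppr_le0.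
by rewrite !mulr_ge0// ltW.
Qed.

(* Chebyshev's association inequality for the decreasing functions
   [u = exp (-2 x L)] and [v = exp (-2 x M)]: if [v x0] is the mean of [v], then
   [(u - u x0) * (v - v x0)] is nonnegative, and its integral is
   [phi (L + M) - phi L * phi M]. *)
Let phi_supermul L M : 0 <= L -> 0 <= M -> phi L * phi M <= phi (L + M).
Proof.
(* M = 0 is set apart because [x0] is defined by a division by M. *)
move=> L0; rewrite le_eqVlt => /predU1P[<-|M0].
  rewrite addr0 -[leRHS]mulr1 ler_wpM2l ?phi_le1//; exact: ltW (phi_gt0 L0).
have M0' := ltW M0.
set c := phi M; have c0 : 0 < c by exact: phi_gt0.
pose x0 := - ln c / (2 * M); pose u0 := expR (- (2 * x0 * L)).
have cE : c = expR (- (2 * x0 * M)).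
  have -> : - (2 * x0 * M) = ln c by rewrite /x0; field; rewrite gt_eqF.
  by rewrite lnK.
pose u x := expR (- (2 * x * L)); pose v x := expR (- (2 * x * M)).
have iu := iexp L0; have iv := iexp M0'.
have iZ (r : R) f : mu.-integrable D (EFin \o f) ->
    mu.-integrable D (EFin \o (fun x => r * f x)).
  by move=> /(integrableZl mD r); apply: eq_integrable.
have iD f g : mu.-integrable D (EFin \o f) -> mu.-integrable D (EFin \o g) ->
    mu.-integrable D (EFin \o (fun x => f x + g x)).
  by move=> hf hg; apply: eq_integrable (integrableD mD hf hg).
(* The terms u0 v and - u0 c cancel on integration, since c is the mean of v. Subtracted from u v,
   this integrand leaves (u - u0) (v - c). *)
have -> : phi L * c = \int[mu]_(x in D) (c * u x + (u0 * v x + - (u0 * c))).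
  rewrite RintegralD//; [|exact: iZ|by apply: iD; [exact: iZ|exact: icst]].
  rewrite RintegralD//; last exact: iZ.
  by rewrite !RintegralZl// int_cst -/(phi L) -/(phi M) -/c; ring.
apply: le_Rintegral => //.
- exact: (iD _ _ (iZ _ _ iu) (iD _ _ (iZ _ _ iv) (icst _))).
- by apply: iexp; rewrite addr_ge0.
move=> x _; rewrite mulrDr opprD expRD -/(u x) -/(v x) -subr_ge0.
have -> : u x * v x - (c * u x + (u0 * v x + - (u0 * c))) = (u x - u0) * (v x - c).
  by ring.
have [xx0|/ltW xx0] := leP x x0.
  by rewrite mulr_ge0// subr_ge0 ?cE ler_expR lerN2 ler_wpM2r// ler_wpM2l.
by rewrite mulr_le0// subr_le0 ?cE ler_expR lerN2 ler_wpM2r// ler_wpM2l.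
Qed.

Lemma weight_gt0 k : 0 < weight mu k.
Proof. by rewrite weightE phi_gt0// ln_ge0// ler1n. Qed.

Lemma weight_supermul m n : weight mu m * weight mu n <= weight mu (m.+1 * n.+1).-1.
Proof.
rewrite !weightE prednK ?muln_gt0// natrM lnM ?posrE ?ltr0n//.
by apply: phi_supermul; rewrite ln_ge0// ler1n.
Qed.

End laplace_weights.

(** * Dirichlet series *)

Section complex_exponential.
Context {R : realType}.
Implicit Types (z s : R[i]) (x y : R).

Lemma cexpD z1 z2 : cexp (z1 + z2) = cexp z1 * cexp z2.
Proof.
case: z1 z2 => [a b] [c d]; rewrite /cexp /= expRD cosD sinD; simpc.
by apply/eqP; rewrite eq_complex /=; apply/andP; split; apply/eqP; ring.
Qed.

Lemma cexp_real x : cexp x%:C = (expR x)%:C.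
Proof. by rewrite /cexp /= cos0 sin0; simpc. Qed.

Lemma normc_cexp z : normc (cexp z) = expR (complex.Re z).
Proof.
rewrite normcM normc_real ger0_norm ?expR_ge0//.
by rewrite /normc cos2Dsin2 sqrtr1 mulr1.
Qed.

(** The inequality 1 + y <= exp y, at y = x and at y = - x. *)
Lemma expR_sub1_bounds x : x <= expR x - 1 <= x * expR x.
Proof.
apply/andP; split; first by have := expR_ge1Dx x; lra.
have := expR_ge1Dx (- x); rewrite expRN => h.
have := expR_gt0 x => e0.
have : (1 - x) * expR x <= 1 by rewrite -ler_pdivlMr// div1r.
by lra.
Qed.

Lemma expR_taylor1 x : `|expR x - 1| <= `|x| * expR `|x|.
Proof.
have /andP[h1 h2] := expR_sub1_bounds x.
have e1 : 1 <= expR `|x| by rewrite -expR0 ler_expR.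
have e2 : expR x <= expR `|x| by rewrite ler_expR ler_norm.
rewrite ler_norml; apply/andP; split.
  have : `|x| <= `|x| * expR `|x| by rewrite ler_peMr.
  by have := ler_norm (- x); rewrite normrN; lra.
rewrite (le_trans h2)// (le_trans (ler_norm _))// normrM ler_wpM2l//.
by rewrite ger0_norm// expR_ge0.
Qed.

Lemma expR_taylor2 x : `|expR x - 1 - x| <= x ^+ 2 * expR `|x|.
Proof.
have /andP[h1 h2] := expR_sub1_bounds x.
rewrite ger0_norm ?subr_ge0//.
have -> : x ^+ 2 * expR `|x| = `|x| * (`|x| * expR `|x|).
  by rewrite mulrA -expr2 real_normK ?num_real.
apply: (@le_trans _ _ (x * (expR x - 1))); first by rewrite mulrBr mulr1; lra.
rewrite (le_trans (ler_norm _))// normrM ler_wpM2l//; exact: expR_taylor1.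
Qed.

Lemma sin_mvt x : 0 <= x -> exists2 c, 0 <= c <= x & sin x = cos c * x.
Proof.
move=> x0; have csin : {within `[0, x], continuous (@sin R)}.
  by apply: continuous_subspaceT => y; exact: continuous_sin.
have [c] := MVT_segment x0 (fun y _ => is_derive_sin y) csin.
by rewrite in_itv/= sin0 !subr0 => cx sE; exists c.
Qed.

Lemma sin_le x : `|sin x| <= `|x|.
Proof.
wlog x0 : x / 0 <= x.
  move=> h; have [/h//|/ltW x0] := leP 0 x.
  by rewrite -normrN -sinN -[leRHS]normrN h// oppr_ge0.
have [c _ ->] := sin_mvt x0; rewrite normrM ler_piMl//.
exact: cos_max.
Qed.

Lemma cos_taylor1 x : 0 <= 1 - cos x <= x ^+ 2 / 2.
Proof.
have h : 1 - cos x = 2 * sin (x / 2) ^+ 2.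
  rewrite {1}(splitr x) cosD; have := cos2Dsin2 (x / 2); rewrite -!expr2; lra.
rewrite h mulr_ge0 ?sqr_ge0//=.
have : sin (x / 2) ^+ 2 <= (x / 2) ^+ 2.
  rewrite -[leLHS]real_normK ?num_real// -[leRHS]real_normK ?num_real//.
  by rewrite ler_sqr ?nnegrE// sin_le.
by lra.
Qed.

Lemma sin_taylor x : `|sin x - x| <= x ^+ 2.
Proof.
wlog x0 : x / 0 <= x.
  move=> h; have [/h//|/ltW x0] := leP 0 x.
  have := h (- x); rewrite oppr_ge0 => /(_ x0); rewrite sinN sqrrN -opprD normrN.
  by [].
have [c /andP[c0 cx] ->] := sin_mvt x0.
have -> : cos c * x - x = - ((1 - cos c) * x) by ring.
rewrite normrN normrM (ger0_norm x0) expr2 ler_wpM2r//.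
have /andP[h1 h2] := cos_taylor1 c; rewrite ger0_norm//.
(* 1 - cos c is at most c^2 / 2 and at most 2; one of these bounds is <= c, and c <= x. *)
have [c2|c2] := leP c 2; first by nra.
by have := cos_geN1 c; lra.
Qed.

(** The real and the imaginary part each split into two errors of size at most |z|^2 exp |z|, which
    gives the 4. The quadratic bound is what allows termwise differentiation. *)
Lemma cexp_taylor z :
  normc (cexp z - 1 - z) <= 4 * normc z ^+ 2 * expR (normc z).
Proof.
have hx := Re_le_normc z; have hy := Im_le_normc z.
rewrite (le_trans (normc_le_ReIm _))//.
case: z hx hy => x y; rewrite [complex.Re _]/= [complex.Im (x +i* y)]/=.
set n := normc _ => hx hy.
have n0 : 0 <= n by exact: normc_ge0.
have -> : complex.Re (cexp (x +i* y) - 1 - (x +i* y)) =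
    (expR x - 1 - x) + - (expR x * (1 - cos y)).
  by rewrite /cexp /=; ring.
have -> : complex.Im (cexp (x +i* y) - 1 - (x +i* y)) =
    (expR x - 1) * sin y + (sin y - y).
  by rewrite /cexp /=; ring.
have ex : expR `|x| <= expR n by rewrite ler_expR.
have en : 1 <= expR n by rewrite -expR0 ler_expR.
have x2 : x ^+ 2 <= n ^+ 2 by rewrite -real_normK ?num_real// ler_sqr.
have y2 : y ^+ 2 <= n ^+ 2 by rewrite -real_normK ?num_real// ler_sqr.
have exn : expR x <= expR n by rewrite ler_expR (le_trans (ler_norm _)).
have b1 : `|expR x - 1 - x| <= n ^+ 2 * expR n.
  by rewrite (le_trans (expR_taylor2 x))// ler_pM ?sqr_ge0 ?expR_ge0.
have b2 : `|expR x * (1 - cos y)| <= n ^+ 2 * expR n.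
  have /andP[h1 h2] := cos_taylor1 y.
  rewrite normrM !ger0_norm ?expR_ge0// [leRHS]mulrC ler_pM ?expR_ge0//.
  by have := sqr_ge0 y; lra.
have b3 : `|(expR x - 1) * sin y| <= n ^+ 2 * expR n.
  rewrite normrM expr2 mulrAC ler_pM//.
    by rewrite (le_trans (expR_taylor1 x))// ler_pM ?expR_ge0.
  exact: le_trans (sin_le y) hy.
have b4 : `|sin y - y| <= n ^+ 2 * expR n.
  by rewrite (le_trans (sin_taylor y))// (le_trans y2)// ler_peMr ?sqr_ge0.
have := ler_normD (expR x - 1 - x) (- (expR x * (1 - cos y))).
have := ler_normD ((expR x - 1) * sin y) (sin y - y).
rewrite normrN -mulrA; lra.
Qed.

End complex_exponential.

(** * Polynomial growth of coefficients and absolute convergence *)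

Section dirichlet_series.
Context {R : realType}.
Implicit Types (a b : nat -> R[i]) (s z : R[i]).

Lemma dsumE a s : dsum a s = csum (fun k => a k * npow k.+1 s).
Proof. by []. Qed.

Definition lnS k : R := ln k.+1%:R.

Lemma lnS_ge0 k : 0 <= lnS k. Proof. by rewrite ln_ge0// ler1n. Qed.

Lemma lnS_le k : lnS k <= k.+1%:R.
Proof.
rewrite /lnS -[in leLHS]nat1r (le_trans (le_ln1Dx _)) ?ler_nat//.
exact: lt_le_trans (ltrN10 _) (ler0n _ _).
Qed.

Lemma expR_lnS k r : expR (r%:R * lnS k) = k.+1%:R ^+ r.
Proof. by rewrite expRM_natl lnK// posrE ltr0n. Qed.

Lemma normc_npow k s : normc (npow k.+1 s) = expR (- (complex.Re s * lnS k)).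
Proof.
rewrite normc_cexp; congr expR; case: s => x y; rewrite /lnS /=.
by rewrite mulr0 subr0 mulNr.
Qed.

Lemma npowD k s z : npow k (s + z) = npow k s * npow k z.
Proof. by rewrite /npow opprD mulrDl cexpD. Qed.

Lemma npowM m n s : npow (m.+1 * n.+1) s = npow m.+1 s * npow n.+1 s.
Proof.
by rewrite /npow natrM lnM ?posrE ?ltr0n// rmorphD mulrDr cexpD.
Qed.

Lemma npow_real k (t : R) : npow k.+1 t%:C = (expR (- (t * lnS k)))%:C.
Proof. by rewrite /npow mulNr -rmorphM -rmorphN cexp_real. Qed.

(** Induction on the sharper bound 2 - 2 / (n + 1), from 1 / (k + 1)^2 <= 2 / ((k + 1) (k + 2)),
    which telescopes. *)
Lemma sum_inv_sqr_le n : \sum_(0 <= k < n) (k.+1%:R ^+ 2)^-1 <= 2 :> R.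
Proof.
suff h : \sum_(0 <= k < n) (k.+1%:R ^+ 2)^-1 <= 2 - 2 / n.+1%:R :> R.
  by rewrite (le_trans h)// gerBl divr_ge0 ?ler0n.
elim: n => [|n ih]; first by rewrite big_geq// divr1 subrr.
rewrite big_nat_recr//= (le_trans (lerD ih (lexx _)))//.
have : 1 <= n.+1%:R :> R by rewrite ler1n.
rewrite -[n.+2%:R]natr1; move: (n.+1%:R) => x x1.
have x0 : 0 < x by exact: lt_le_trans ltr01 x1.
rewrite -subr_ge0.
have -> : 2 - 2 / (x + 1) - (2 - 2 / x + (x ^+ 2)^-1) = (x - 1) / (x ^+ 2 * (x + 1)).
  by field; rewrite !gt_eqF ?addr_gt0.
by rewrite divr_ge0 ?subr_ge0// mulr_ge0 ?sqr_ge0// addr_ge0// ltW.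
Qed.

(** Convergence at one point is equivalent to polynomial growth of the coefficients. With integer
    exponents the growth condition gives explicit half-planes of absolute convergence, and no
    abscissa has to be introduced. *)
Definition polybound a (r : nat) (M : R) :=
  0 <= M /\ forall k, normc (a k) <= M * k.+1%:R ^+ r.

Lemma polybound_term a r M s : polybound a r M -> (r + 2)%:R <= complex.Re s ->
  forall k, normc (a k * npow k.+1 s) <= M * (k.+1%:R ^+ 2)^-1.
Proof.
move=> [M0 aM] rs k; rewrite normcM normc_npow.
apply: (@le_trans _ _ (M * k.+1%:R ^+ r * expR (- ((r + 2)%:R * lnS k)))).
  rewrite ler_pM ?normc_ge0 ?expR_ge0 ?aM// ler_expR lerN2.
  by rewrite ler_wpM2r ?lnS_ge0.
by rewrite expRN expR_lnS exprD invfM -!mulrA ler_wpM2l// mulrA mulfV ?mul1r//.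
Qed.

Lemma polybound_sum a r M s : polybound a r M -> (r + 2)%:R <= complex.Re s ->
  forall n, \sum_(0 <= k < n) normc (a k * npow k.+1 s) <= M * 2.
Proof.
move=> aM rs; apply: asummable_le (polybound_term aM rs) _ => n.
by rewrite -mulr_sumr ler_wpM2l ?aM.1 ?sum_inv_sqr_le.
Qed.

Lemma polybound_asummable a r M s :
  polybound a r M -> (r + 2)%:R <= complex.Re s ->
  asummable (fun k => a k * npow k.+1 s).
Proof. by move=> aM rs; exists (M * 2); exact: (polybound_sum aM). Qed.

Lemma polybound_dconvergent a r M : polybound a r M -> dconvergent a.
Proof.
move=> aM; exists ((r + 2)%:R)%:C.
by apply: (@cseries_cvg _ _ (M * 2)); exact: (polybound_sum aM).
Qed.

(** The terms of a convergent series are bounded: from N on they are differences of partial sums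
    within 1 of the limit, and the earlier ones are absorbed into [M]. Hence |a_k| <= M (k + 1)^(Re
    s), and Re s is rounded up to a natural number. *)
Lemma dconvergent_polybound a : dconvergent a -> exists r M, polybound a r M.
Proof.
move=> [s cs].
set u := fun k => a k * npow k.+1 s.
have [N _ hN] : \forall n \near \oo, normc (csum u - \sum_(0 <= k < n) u k) < 1.
  by have /cvg_normcP h := cs; exact: h ltr01.
have uB k : normc (u k) <= 2 + \sum_(0 <= i < N) normc (u i).
  have [kN|Nk] := ltnP k N.
    rewrite (bigD1_seq k) ?iota_uniq ?mem_index_iota//=.
    rewrite addrCA lerDl addr_ge0// sumr_ge0// => i _; exact: normc_ge0.
  apply: (@le_trans _ _ 2); last by rewrite lerDl sumr_ge0// => i _; exact: normc_ge0.
  have := hN k Nk; have /= := hN k.+1 (leqW Nk).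
  rewrite big_nat_recr//= => /ltW h1 /ltW h2.
  have -> : u k = (csum u - \sum_(0 <= i < k) u i)
     + - (csum u - (\sum_(0 <= i < k) u i + u k)) by ring.
  rewrite (le_trans (normc_le_add _ _))// normc_opp.
  by rewrite [leRHS](_ : _ = 1 + 1)// lerD.
set M := 2 + _ in uB.
have [r rs] : exists r : nat, complex.Re s <= r%:R.
  exists (Num.truncn `|complex.Re s|).+1; rewrite (le_trans (ler_norm _))// ltW//.
  exact: truncnS_gt.
exists r, M; split; first exact: le_trans (normc_ge0 _) (uB 0%N).
move=> k; have := uB k; rewrite /u normcM normc_npow expRN -ler_pdivlMr; last first.
  by rewrite invr_gt0 expR_gt0.
rewrite invrK => /le_trans; apply; rewrite ler_wpM2l//.
  exact: le_trans (normc_ge0 _) (uB 0%N).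
by rewrite -expR_lnS ler_expR ler_wpM2r ?lnS_ge0.
Qed.

(** These are the coefficients of the derivative; the logarithm costs one power. *)
Lemma polybound_mul_lnS a r M : polybound a r M ->
  polybound (fun k => - (a k * (lnS k)%:C)) r.+1 M.
Proof.
move=> [M0 aM]; split=> // k; rewrite normc_opp normcM normc_real ger0_norm ?lnS_ge0//.
by rewrite exprSr mulrA ler_pM ?normc_ge0 ?lnS_ge0// lnS_le.
Qed.

Lemma polybound_lin (c : R[i]) a b r1 M1 r2 M2 : polybound a r1 M1 -> polybound b r2 M2 ->
  polybound (fun k => c * a k + b k) (r1 + r2) (normc c * M1 + M2).
Proof.
move=> [M10 aM] [M20 bM]; split; first by rewrite addr_ge0// mulr_ge0// normc_ge0.
move=> k; rewrite (le_trans (normc_le_add _ _))// mulrDl normcM -mulrA lerD//.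
  rewrite ler_wpM2l ?normc_ge0// (le_trans (aM k))// ler_wpM2l//.
  by rewrite ler_weXn2l ?ler1n// leq_addr.
by rewrite (le_trans (bM k))// ler_wpM2l// ler_weXn2l ?ler1n// leq_addl.
Qed.

End dirichlet_series.

(** * Termwise differentiation *)

Section dirichlet_calculus.
Context {R : realType}.
Implicit Types (a b : nat -> R[i]) (s z : R[i]).

(** [cexp_taylor] at - h ln n, with n = k + 1. Since |h| <= 1, exp (|h| ln n) <= n, so the remainder
    factor is at most 4 |h|^2 n^3. For Re z >= r + 5 the k-th term is then at most 4 M |h|^2 / n^2,
    and the sum of 1 / n^2 is at most 2. *)
Lemma dsum_taylor a r M z h : polybound a r M -> (r + 5)%:R <= complex.Re z ->
  normc h <= 1 ->
  normc (dsum a (h + z) - dsum a z - h * dsum (fun k => - (a k * (lnS k)%:C)) z)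
    <= 8 * M * normc h ^+ 2.
Proof.
move=> aM rz h1.
have Re_h : - 1 <= complex.Re h.
  by have := le_trans (Re_le_normc h) h1; rewrite ler_norml => /andP[].
have Re_hz : complex.Re (h + z) = complex.Re h + complex.Re z.
  by case: (h) (z) => ? ? [].
rewrite natrD in rz.
have s1 : asummable (fun k => a k * npow k.+1 (h + z)).
  by apply: polybound_asummable aM _; rewrite natrD Re_hz; lra.
have s2 : asummable (fun k => a k * npow k.+1 z).
  by apply: polybound_asummable aM _; rewrite natrD; lra.
have s3 : asummable (fun k => - (a k * (lnS k)%:C) * npow k.+1 z).
  by apply: polybound_asummable (polybound_mul_lnS aM) _; rewrite -addn1 !natrD; lra.
have s4 : asummable (fun k => -1 * (a k * npow k.+1 z) + a k * npow k.+1 (h + z)).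
  case: s1 s2 => [B1 s1] [B2 s2]; exists (B2 + B1) => n.
  apply: le_trans (lerD (s2 n) (s1 n)); rewrite -big_split/= ler_sum// => k _.
  by rewrite (le_trans (normc_le_add _ _))// mulN1r normc_opp.
rewrite !dsumE -[X in normc X](_ : (- h) * csum (fun k => - (a k * (lnS k)%:C) * npow k.+1 z) +
   (-1 * csum (fun k => a k * npow k.+1 z) + csum (fun k => a k * npow k.+1 (h + z))) = _);
  last by ring.
rewrite -!csum_lin//.
have -> : 8 * M * normc h ^+ 2 = 4 * M * normc h ^+ 2 * 2 by ring.
have M0 := aM.1.
apply: normc_csum_le.
apply: (@asummable_le _ _ (fun k => 4 * M * normc h ^+ 2 * (k.+1%:R ^+ 2)^-1)); last first.
  move=> n; rewrite -mulr_sumr ler_wpM2l ?sum_inv_sqr_le//.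
  by rewrite !mulr_ge0// normc_ge0.
move=> k; rewrite npowD.
have -> : - h * (- (a k * (lnS k)%:C) * npow k.+1 z) +
   (-1 * (a k * npow k.+1 z) + a k * (npow k.+1 h * npow k.+1 z)) =
   a k * npow k.+1 z * (cexp (- h * (lnS k)%:C) - 1 - (- h * (lnS k)%:C)).
  by rewrite /npow -/(lnS k); ring.
rewrite normcM normcM.
have := cexp_taylor (- h * (lnS k)%:C).
rewrite normcM normc_opp normc_real ger0_norm ?lnS_ge0//.
set x : R := k.+1%:R.
have x1 : 1 <= x by rewrite ler1n.
have x0 : 0 < x by exact: lt_le_trans ltr01 x1.
have e1 : expR (normc h * lnS k) <= x.
  by rewrite -[x]expr1 -expR_lnS ler_expR ler_wpM2r// lnS_ge0.
move=> ht; have L1 : lnS k <= x by exact: lnS_le.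
have L0 := @lnS_ge0 R k.
have hk2 : normc (cexp (- h * (lnS k)%:C) - 1 - - h * (lnS k)%:C) <=
    4 * normc h ^+ 2 * x ^+ 3.
  rewrite (le_trans ht)// exprMn.
  have -> : 4 * normc h ^+ 2 * x ^+ 3 = 4 * (normc h ^+ 2 * x ^+ 2) * x by ring.
  apply: ler_pM; rewrite ?expR_ge0//.
    by rewrite mulr_ge0// mulr_ge0 ?sqr_ge0.
  by rewrite ler_wpM2l// ler_wpM2l ?sqr_ge0// ler_sqr ?nnegrE// ltW.
have ak : normc (a k) * normc (npow k.+1 z) <= M * (x ^+ 5)^-1.
  rewrite normc_npow; apply: (@le_trans _ _ (M * x ^+ r * expR (- ((r + 5)%:R * lnS k)))).
    rewrite ler_pM ?normc_ge0 ?expR_ge0 ?aM.2// ler_expR lerN2.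
    by rewrite ler_wpM2r// natrD.
  rewrite expRN expR_lnS -/x exprD invfM -!mulrA ler_wpM2l// mulrA mulfV ?mul1r//.
  by rewrite expf_neq0// gt_eqF.
apply: (le_trans (ler_pM _ _ ak hk2)); rewrite ?mulr_ge0 ?normc_ge0//.
rewrite le_eqVlt; apply/orP; left; apply/eqP; field.
by rewrite gt_eqF.
Qed.

Lemma cderive_dsum a r M z : polybound a r M -> (r + 5)%:R <= complex.Re z ->
  cderive (dsum a) z = dsum (fun k => - (a k * (lnS k)%:C)) z.
Proof.
move=> aM rz; rewrite /cderive /derive1.
apply: (@cvg_lim (R[i]^o)); first exact: norm_hausdorff.
apply/cvg_normcP => ep ep0.
(* The bound 1 meets the condition of [dsum_taylor]; the 1 added to 8 M covers M = 0. *)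
pose d := Num.min 1 (ep / (8 * M + 1)).
have M0 : 0 < 8 * M + 1 by rewrite ltr_wpDl// mulr_ge0// aM.1.
have d0 : 0 < d by rewrite lt_min ltr01 divr_gt0.
near=> h.
have hn0 : h != 0 by near: h; exact: nbhs_dnbhs_neq.
have hd : normc h < d.
  have : `|h| < d%:C by near: h; apply: dnbhs0_lt; rewrite (ltcR 0).
  by rewrite normcE ltcR.
have hp : 0 < normc h by rewrite normc_gt0.
have [h1 he] : normc h <= 1 /\ normc h < ep / (8 * M + 1).
  by move: hd; rewrite lt_min => /andP[/ltW].
have := dsum_taylor aM rz h1.
set l := dsum (fun k => - (a k * (lnS k)%:C)) z => ht.
rewrite -[X in normc X]/(l - h^-1 * (dsum a (h + z) - dsum a z)).
have -> : l - h^-1 * (dsum a (h + z) - dsum a z) =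
    - (h^-1 * (dsum a (h + z) - dsum a z - h * l)).
  by field.
rewrite normc_opp normcM normcV mulrC ltr_pdivrMr// (le_lt_trans ht)//.
rewrite expr2 mulrA ltr_pM2r//.
apply: (@le_lt_trans _ _ ((8 * M + 1) * normc h)).
  by rewrite ler_wpM2r ?normc_ge0// lerDl.
by rewrite mulrC -ltr_pdivlMr.
Unshelve. all: by end_near. Qed.

End dirichlet_calculus.

(** * Uniqueness of coefficients and sums over multiples *)

Section dirichlet_coefficients.
Context {R : realType}.
Implicit Types (a b : nat -> R[i]) (s z : R[i]).

Lemma csum_single (c : R[i]) n : csum (fun k => if k == n then c else 0) = c.
Proof.
apply: csum_lim => e e0; near=> m.
rewrite (bigD1_seq n) ?iota_uniq ?mem_index_iota//=; last by near: m; exact: nbhs_infty_gt.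
rewrite eqxx big1 ?addr0 ?subrr ?normc0// => k /negbTE ->; by [].
Unshelve. all: by end_near. Qed.

Lemma asummable_single (c : R[i]) n : asummable (fun k => if k == n then c else 0).
Proof.
exists (normc c) => m; have [nm|mn] := ltnP n m.
  rewrite (bigD1_seq n) ?iota_uniq ?mem_index_iota//= eqxx big1 ?addr0//.
  by move=> k /negbTE ->; rewrite normc0.
rewrite big_seq big1 ?normc_ge0// => k; rewrite mem_index_iota => /andP[_ km].
by rewrite ifF ?normc0//; apply/eqP => kn; move: km; rewrite kn ltnNge mn.
Qed.

(* Evaluating at large real [x = r + 2 + y] isolates the first nonzero
   coefficient: the terms of index [> n] are smaller by the factor
   [((n + 1) / (n + 2)) ^ y]. *)
Lemma dsum_eq0_coef a r M (y0 : nat) : polybound a r M ->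
  (forall y : nat, (y0 <= y)%N -> dsum a ((r + 2 + y)%:R)%:C = 0) ->
  forall n, a n = 0.
Proof.
move=> aM a0; have M0 := aM.1.
apply: ltn_ind => n ih.
pose q : R := n.+1%:R / n.+2%:R.
have bound y : (y0 <= y)%N -> normc (a n) <= M * 2 * n.+1%:R ^+ (r + 2) * q ^+ y.
  move=> /a0; set x := (r + 2 + y)%N; rewrite dsumE.
  have npx k : npow k.+1 (x%:R)%:C = ((k.+1%:R ^+ x)^-1)%:C :> R[i].
    by rewrite npow_real expRN expR_lnS.
  pose v k := if (k <= n)%N then 0 else a k * npow k.+1 (x%:R)%:C.
  have -> : (fun k => a k * npow k.+1 (x%:R)%:C) =
      (fun k => 1 * (if k == n then a n * npow n.+1 (x%:R)%:C else 0) + v k).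
    apply/funext => k; rewrite /v mul1r; case: ltngtP => [kn|kn|->].
    - by rewrite ih// mul0r addr0.
    - by rewrite add0r.
    - by rewrite addr0.
  have vB m : \sum_(0 <= k < m) normc (v k) <= M * (n.+2%:R ^+ y)^-1 * 2.
    apply: (@asummable_le _ _ (fun k => M * (n.+2%:R ^+ y)^-1 * (k.+1%:R ^+ 2)^-1)).
      move=> k; rewrite /v; case: leqP => [_|nk].
        by rewrite normc0 !mulr_ge0 ?invr_ge0 ?exprn_ge0.
      rewrite normcM npx normc_real ger0_norm ?invr_ge0 ?exprn_ge0//.
      apply: (@le_trans _ _ (M * k.+1%:R ^+ r * (k.+1%:R ^+ x)^-1)).
        by rewrite ler_wpM2r ?invr_ge0 ?exprn_ge0 ?aM.2.
      have xE (A B C : R) : A != 0 -> A * (A * B * C)^-1 = C^-1 * B^-1.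
        by move=> A0; rewrite !invfM -!mulrA mulVKf// mulrC.
      have -> : M * k.+1%:R ^+ r * (k.+1%:R ^+ x)^-1 =
          M * (k.+1%:R ^+ y)^-1 * (k.+1%:R ^+ 2)^-1.
        by rewrite /x !exprD -[LHS]mulrA xE ?expf_neq0 ?pnatr_eq0// mulrA.
      rewrite ler_wpM2r ?invr_ge0 ?exprn_ge0// ler_wpM2l//.
      by rewrite lef_pV2 ?posrE ?exprn_gt0// lerXn2r ?nnegrE ?ler0n// ler_nat.
    by move=> m'; rewrite -mulr_sumr ler_wpM2l ?sum_inv_sqr_le// mulr_ge0// invr_ge0 exprn_ge0.
  rewrite csum_lin; [|exact: asummable_single|by eexists; exact: vB].
  rewrite csum_single mul1r => /eqP; rewrite addr_eq0 => /eqP h.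
  have := normc_csum_le vB; rewrite -normc_opp -h normcM npx normc_real.
  rewrite ger0_norm ?invr_ge0 ?exprn_ge0// ler_pdivrMr ?exprn_gt0//.
  move=> /le_trans; apply; rewrite /x exprD /q expr_div_n le_eqVlt.
  by apply/orP; left; apply/eqP; ring.
have q1 : `|q| < 1.
  by rewrite ger0_norm ?divr_ge0// ltr_pdivrMr// mul1r ltr_nat.
apply/eqP; rewrite -normc_eq0 eq_le normc_ge0 andbT.
have h : M * 2 * n.+1%:R ^+ (r + 2) * q ^+ y @[y --> \oo] --> M * 2 * n.+1%:R ^+ (r + 2) * 0.
  by apply: cvgMl_tmp; exact: cvg_expr.
rewrite mulr0 in h; rewrite -(cvg_lim (@Rhausdorff R) h).
apply: limr_ge; first exact: cvgP h.
by exists y0.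
Qed.

(** The difference b - a vanishes at all large integers. This uniqueness pins down the series that
    [xget] selects in [volterra]. *)
Lemma dsum_inj a b (sigma : R) : dconvergent a -> dconvergent b ->
  (forall s, sigma < complex.Re s -> dsum a s = dsum b s) -> a = b.
Proof.
move=> /dconvergent_polybound[r1 [M1 aM]] /dconvergent_polybound[r2 [M2 bM]] ab.
apply/funext => n; apply/eqP; rewrite eq_sym -subr_eq0 addrC -mulN1r.
apply/eqP; apply: (dsum_eq0_coef (y0 := (Num.truncn `|sigma|).+1)
  (polybound_lin (-1) aM bM)) => y yy.
set x := _%:C; rewrite dsumE.
have -> : (fun k => (-1 * a k + b k) * npow k.+1 x) =
    (fun k => -1 * (a k * npow k.+1 x) + b k * npow k.+1 x).
  by apply/funext => k; rewrite mulrDl -mulrA.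
rewrite csum_lin.
- rewrite -!dsumE ab; first by rewrite mulN1r addNr.
  rewrite /x /= (le_lt_trans (ler_norm _))// (lt_le_trans (truncnS_gt _))//.
  by rewrite ler_nat (leq_trans yy)// leq_addl.
- by apply: polybound_asummable aM _; rewrite /x /= ler_nat; lia.
- by apply: polybound_asummable bM _; rewrite /x /= ler_nat; lia.
Qed.

(** Each block of m + 1 consecutive indices contains one multiple, at its end, so the partial sum of
    length (m + 1) J on the left is the partial sum of length J on the right. *)
Lemma csum_multiples (u : nat -> R[i]) m : asummable u ->
  (forall k, ~~ (m.+1 %| k.+1)%N -> u k = 0) ->
  csum u = csum (fun j => u (m.+1 * j.+1).-1).
Proof.
move=> /csum_cvg us u0.
have sE J : \sum_(0 <= k < m.+1 * J) u k = \sum_(0 <= j < J) u (m.+1 * j.+1).-1.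
  elim: J => [|J ih]; first by rewrite muln0 !big_geq.
  have le1 : (m.+1 * J <= m.+1 * J + m)%N by exact: leq_addr.
  have eJ : (m.+1 * J.+1 = (m.+1 * J + m).+1)%N by rewrite mulnS addnC addnS addnC.
  rewrite [RHS]big_nat_recr// -ih eJ big_nat_recr// (big_cat_nat (leq0n _) le1)/=.
  rewrite [X in _ + X + _]big_seq [X in _ + X + _]big1 ?addr0// => k.
  rewrite mem_index_iota => /andP[k1 k2]; apply: u0; apply/negP => /dvdnP[d kd].
  have : (m.+1 * J < d * m.+1 < m.+1 * J.+1)%N by rewrite -kd eJ !ltnS k1.
  by rewrite mulnC ltn_mul2r mulnC ltn_mul2l/= => /andP[]; rewrite ltnS leqNgt => /negP.
apply/esym/csum_lim => e e0; have [N _ hN] := us e e0.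
exists N => // J /= NJ; rewrite -sE; apply: hN => /=.
by rewrite (leq_trans NJ)// leq_pmull.
Qed.

End dirichlet_coefficients.

(** * The half-line integral of a Laplace-type series *)

Section laplace_sums.
Context {R : realType}.
Local Notation lam := (@lebesgue_measure R).
Local Notation D := (`[0, +oo[%classic : set (measurableTypeR R)).

Let mD : measurable D. Proof. exact: measurable_itv. Qed.

Let e (L : R) (t : R) : R := expR (- (t * L)).

Lemma measurable_expRN (L : R) : measurable_fun D (e L).
Proof.
apply: measurable_funTS; apply: measurableT_comp; first exact: measurable_expR.
by apply: measurable_funN; exact: measurable_funM.
Qed.

(** The density L exp (- L t) of the exponential law has total mass 1. *)
Lemma integral_expRN (L : R) : 0 < L ->
  (\int[lam]_(t in D) (e L t)%:E)%E = (L^-1)%:E.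
Proof.
move=> L0; have := integral_exponential_pdf L0.
have -> : (\int[lam]_t (exponential_pdf L t)%:E)%E =
    (\int[lam]_(t in D) (L * expR (- L * t))%:E)%E.
  rewrite [RHS]integral_mkcond; apply: eq_integral => t _.
  by rewrite /exponential_pdf !patchE; case: ifP.
have -> : (\int[lam]_(t in D) (L * expR (- L * t))%:E)%E =
    (L%:E * \int[lam]_(t in D) (e L t)%:E)%E.
  rewrite -ge0_integralZl//; last 3 first.
  - by have /measurable_EFinP := measurable_expRN L.
  - by move=> t _; rewrite lee_fin expR_ge0.
  - by rewrite lee_fin ltW.
  by apply: eq_integral => t _; rewrite EFinM /e mulNr mulrC.
move=> h.
have : (L^-1)%:E = (L^-1%:E * (L%:E * \int[lam]_(t in D) (e L t)%:E))%E.
  by rewrite h mule1.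
by move=> ->; rewrite muleA -EFinM mulVf ?gt_eqF// mul1e.
Qed.

Lemma integrable_expRN (L : R) : 0 < L -> lam.-integrable D (EFin \o e L).
Proof.
move=> L0; apply/integrableP; split.
  by have /measurable_EFinP := measurable_expRN L.
under eq_integral do rewrite /= ger0_norm ?expR_ge0//.
by rewrite integral_expRN// ltry.
Qed.

Variables (x Lam : nat -> R) (B delta : R).
Hypotheses (xB : forall n, \sum_(0 <= k < n) `|x k| <= B) (delta_gt0 : 0 < delta)
  (xLam : forall k, x k = 0 \/ delta <= Lam k).

Let term_integrable k : lam.-integrable D (EFin \o (fun t => x k * e (Lam k) t)) /\
  (\int[lam]_(t in D) (x k * e (Lam k) t)%:E)%E = (x k / Lam k)%:E.
Proof.
case: (xLam k) => [->|dL].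
  split; first by apply: eq_integrable (integrable0 lam D) => // t _; rewrite /= mul0r.
  by under eq_integral do rewrite mul0r; rewrite integral0 mul0r.
have L0 : 0 < Lam k by exact: lt_le_trans dL.
have iL := integrable_expRN L0; split.
  by apply: eq_integrable (integrableZl mD (x k) iL).
under eq_integral do rewrite EFinM.
by rewrite integralZl// integral_expRN.
Qed.

Let psum_integrable n :
  lam.-integrable D (EFin \o (fun t => \sum_(0 <= k < n) x k * e (Lam k) t)) /\
  (\int[lam]_(t in D) (\sum_(0 <= k < n) x k * e (Lam k) t)%:E)%E =
    (\sum_(0 <= k < n) x k / Lam k)%:E.
Proof.
elim: n => [|n [ih1 ih2]].
  split.
    by apply: eq_integrable (integrable0 lam D) => // t _; rewrite /= big_geq.
  by under eq_integral do rewrite big_geq//; rewrite integral0 big_geq.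
have [i1 i2] := term_integrable n.
split.
  apply: eq_integrable (integrableD mD ih1 i1) => // t _.
  by rewrite /= big_nat_recr.
under eq_integral do rewrite big_nat_recr// EFinD.
by rewrite integralD// ih2 i2 big_nat_recr.
Qed.

Let abs_term_le t k : D t -> `|x k * e (Lam k) t| <= `|x k| * e delta t.
Proof.
rewrite /= in_itv/= andbT => t0; rewrite normrM (ger0_norm (expR_ge0 _)).
case: (xLam k) => [->|dL]; first by rewrite normr0 !mul0r.
by rewrite ler_wpM2l// ler_expR lerN2 ler_wpM2l.
Qed.

Let abs_psum_le t n : D t -> \sum_(0 <= k < n) `|x k * e (Lam k) t| <= B * e delta t.
Proof.
move=> Dt; apply: (@le_trans _ _ ((\sum_(0 <= k < n) `|x k|) * e delta t)).
  by rewrite mulr_suml ler_sum// => k _; exact: abs_term_le.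
by rewrite ler_wpM2r// expR_ge0.
Qed.

(** Dominated convergence with majorant B exp (- delta t). The alternative [x k = 0] is meant for
    the constant term of g, which g' kills and whose exponent may be 0. *)
Lemma Rintegral_laplace_sum (f : R -> R) :
  (forall t, 0 <= t ->
    (\sum_(0 <= k < n) x k * expR (- (t * Lam k))) @[n --> \oo] --> f t) ->
  (\sum_(0 <= k < n) x k / Lam k) @[n --> \oo] --> \int[lam]_(t in D) f t.
Proof.
move=> xf.
have fD t : D t -> (\sum_(0 <= k < n) x k * e (Lam k) t) @[n --> \oo] --> f t.
  by rewrite /= in_itv/= andbT; exact: xf.
have mf : measurable_fun D f.
  apply: (measurable_fun_cvg _ fD) => n.
  exact/measurable_EFinP/measurable_int/(psum_integrable n).1.
have ig : lam.-integrable D (fun t => (B * e delta t)%:E).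
  by apply: eq_integrable (integrableZl mD B (integrable_expRN delta_gt0)).
have [||||/= if1 _ cv] := dominated_convergence mD
   (f_ := fun n t => (\sum_(0 <= k < n) x k * e (Lam k) t)%:E)
   (f := EFin \o f) _ _ _ ig.
- by move=> n; exact: measurable_int (psum_integrable n).1.
- exact/measurable_EFinP.
- apply: aeW => t Dt; apply: cvg_EFin; last exact: fD.
  by apply: nearW.
- apply: aeW => t n Dt; rewrite lee_fin (le_trans _ (abs_psum_le n Dt))//.
  exact: ler_norm_sum.
have h : (\int[lam]_(t in D) f t)%:E = (\int[lam]_(t in D) (f t)%:E)%E.
  by rewrite /Rintegral fineK//; exact: integrable_fin_num.
have /fine_cvg : (\sum_(0 <= k < n) x k / Lam k)%:E @[n --> \oo] -->
    (\int[lam]_(t in D) f t)%:E; last exact.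
rewrite h; apply: cvg_trans cv; apply: near_eq_cvg; apply: nearW => n /=.
by rewrite (psum_integrable n).2.
Qed.

End laplace_sums.

Lemma halfline_integral_laplace {R : realType} (F : R[i] -> R[i]) (s : R[i])
    (c : nat -> R[i]) (Lam : nat -> R) (B delta : R) :
  (forall n, \sum_(0 <= k < n) normc (c k) <= B) -> 0 < delta ->
  (forall k, c k = 0 \/ delta <= Lam k) ->
  (forall t, 0 <= t -> F (s + t%:C) = csum (fun k => c k * (expR (- (t * Lam k)))%:C)) ->
  halfline_integral F s = csum (fun k => c k * ((Lam k)^-1)%:C).
Proof.
move=> cB d0 cL FE; apply/esym/csum_lim.
have B0 : 0 <= B by have := cB 0; rewrite big_geq.
have tsum t : 0 <= t -> ccvg \oo
    (fun n => \sum_(0 <= k < n) c k * (expR (- (t * Lam k)))%:C) (F (s + t%:C)).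
  move=> t0; rewrite FE//; apply: csum_cvg; exists B; apply: asummable_le cB => k.
  rewrite normcM normc_real ger0_norm ?expR_ge0//.
  case: (cL k) => [->|dL]; first by rewrite normc0 mul0r.
  rewrite ler_piMr ?normc_ge0// -expR0 ler_expR oppr_le0 mulr_ge0//.
  exact: le_trans (ltW d0) dL.
have ReZ (z : R[i]) (y : R) : complex.Re (z * y%:C) = complex.Re z * y.
  by case: z => a b; rewrite /= mulr0 subr0.
have ImZ (z : R[i]) (y : R) : complex.Im (z * y%:C) = complex.Im z * y.
  by case: z => a b; rewrite /= mulr0 add0r.
have ReS n (y : nat -> R) : complex.Re (\sum_(0 <= k < n) c k * (y k)%:C) =
    \sum_(0 <= k < n) complex.Re (c k) * y k.
  by rewrite Re_sum; apply: eq_bigr => k _; rewrite ReZ.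
have ImS n (y : nat -> R) : complex.Im (\sum_(0 <= k < n) c k * (y k)%:C) =
    \sum_(0 <= k < n) complex.Im (c k) * y k.
  by rewrite Im_sum; apply: eq_bigr => k _; rewrite ImZ.
apply: ccvg_ReIm => /=.
  under eq_fun do rewrite ReS.
  apply: (@Rintegral_laplace_sum _ _ _ B delta) => //.
  - move=> n; apply: le_trans (cB n); apply: ler_sum => k _; exact: Re_le_normc.
  - by move=> k; case: (cL k) => [->|]; [left|right].
  - by move=> t /tsum/ccvg_Re; under eq_fun do rewrite ReS.
under eq_fun do rewrite ImS.
apply: (@Rintegral_laplace_sum _ _ _ B delta) => //.
- move=> n; apply: le_trans (cB n); apply: ler_sum => k _; exact: Im_le_normc.
- by move=> k; case: (cL k) => [->|]; [left|right].
- by move=> t /tsum/ccvg_Im; under eq_fun do rewrite ImS.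
Qed.

(** * The Volterra operator on monomials *)

Section volterra_monomial.
Context {R : realType}.
Implicit Types (g : nat -> R[i]) (s : R[i]).

Lemma csumZ (c : R[i]) (u : nat -> R[i]) : asummable u ->
  csum (fun k => c * u k) = c * csum u.
Proof.
move=> us; have := csum_lin c us (asummable_single 0 0).
rewrite csum_single addr0 => <-; congr csum; apply/funext => k.
by rewrite if_same addr0.
Qed.

Lemma dsum_monomial m s : dsum (monomial m) s = npow m.+1 s.
Proof.
rewrite dsumE -[RHS](csum_single _ m); congr csum; apply/funext => k.
by rewrite /monomial; case: eqP => [->|_]; rewrite ?mul1r ?mul0r.
Qed.

(** With n = k + 1 = (m + 1) (j + 1), the term - a_{j+1} log (j + 1) n^(-w) of f g' integrates to
    a_{j+1} (log (j + 1) / log n) n^(-s). At n = 1 the quotient 0 / 0 is 0 by convention, as it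
    should be: T_g f has no constant term. *)
Definition volterra_coef g (m k : nat) : R[i] :=
  if (m.+1 %| k.+1)%N then
    let j := (k.+1 %/ m.+1).-1 in g j * (@lnS R j / @lnS R k)%:C
  else 0.

Lemma lnS_mul m j : @lnS R (m.+1 * j.+1).-1 = @lnS R m + @lnS R j.
Proof. by rewrite /lnS prednK ?muln_gt0// natrM lnM ?posrE ?ltr0n. Qed.

Lemma lnS_homo j k : (j <= k)%N -> @lnS R j <= @lnS R k.
Proof. by move=> jk; rewrite /lnS ler_ln ?posrE ?ltr0n// ler_nat. Qed.

Lemma volterra_coefE g m j : volterra_coef g m (m.+1 * j.+1).-1 =
  g j * (@lnS R j / (@lnS R m + @lnS R j))%:C.
Proof.
by rewrite /volterra_coef lnS_mul prednK ?muln_gt0// dvdn_mulr// mulKn.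
Qed.

(** The quotient of logarithms is at most 1 and j <= k, so the bound for g carries over. *)
Lemma polybound_volterra_coef g r M m :
  polybound g r M -> polybound (volterra_coef g m) r M.
Proof.
move=> [M0 gM]; split=> // k; rewrite /volterra_coef; case: ifP => [/dvdnP[d kd]|_]; last first.
  by rewrite normc0 mulr_ge0// exprn_ge0.
have d0 : (0 < d)%N by case: d kd.
rewrite kd mulnK//; set j := d.-1.
have jk : (j <= k)%N by rewrite -ltnS kd /j prednK// leq_pmulr.
rewrite normcM normc_real ger0_norm ?divr_ge0 ?lnS_ge0//.
apply: (@le_trans _ _ (normc (g j))).
  rewrite ler_piMr ?normc_ge0//.
  have [->|k0] := eqVneq (@lnS R k) 0; first by rewrite invr0 mulr0.
  by rewrite ler_pdivrMr ?mul1r ?lnS_homo// lt_def k0 lnS_ge0.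
rewrite (le_trans (gM j))// ler_wpM2l// lerXn2r ?nnegrE// ler_nat.
by rewrite -kd ltnS.
Qed.

(** Along the half-line the integrand is a sum of exponentials in t, which is integrated term by
    term; on the other side the series is reindexed over the multiples of m + 1. The shift r + 5 is
    the one under which g may be differentiated termwise. *)
Lemma is_volterra_monomial g m : dconvergent g ->
  is_volterra g (monomial m) (volterra_coef g m).
Proof.
move=> /dconvergent_polybound[r [M gM]].
have hM := polybound_volterra_coef m gM.
split; first exact: polybound_dconvergent hM.
exists (r + 5)%:R => s rs.
have rs2 : (r + 2)%:R <= complex.Re s.
  by rewrite (le_trans _ (ltW rs))// ler_nat; lia.
have rs3 : (r.+1 + 2)%:R <= complex.Re s.
  by rewrite (le_trans _ (ltW rs))// ler_nat; lia.
have g'M := polybound_mul_lnS gM.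
pose c k := npow m.+1 s * (- (g k * (@lnS R k)%:C) * npow k.+1 s).
have ln2 : 0 < @lnS R 1 by rewrite ln_gt0// ltr1n.
have cB n : \sum_(0 <= k < n) normc (c k) <= normc (npow m.+1 s) * (M * 2).
  apply: le_trans (ler_wpM2l (normc_ge0 _) (polybound_sum g'M rs3 n)).
  by rewrite mulr_sumr ler_sum// => k _; rewrite normcM.
(* Differentiation kills the constant term; every other exponent is at least ln 2 = [lnS 1]. *)
have c0 k : c k = 0 \/ @lnS R 1 <= @lnS R m + @lnS R k.
  case: k => [|k]; first by left; rewrite /c /lnS ln1 !(mulr0, oppr0, mul0r).
  by right; rewrite ler_wpDl ?lnS_ge0// lnS_homo.
have FE t : 0 <= t -> dsum (monomial m) (s + t%:C) * cderive (dsum g) (s + t%:C) =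
    csum (fun k => c k * (expR (- (t * (@lnS R m + @lnS R k))))%:C).
  move=> t0.
  have rst : (r + 5)%:R <= complex.Re (s + t%:C).
    by case: s rs {rs2 rs3 c cB c0} => x y /= rs; rewrite (le_trans (ltW rs))// lerDl.
  rewrite dsum_monomial (cderive_dsum gM)// dsumE -csumZ; last first.
    apply: polybound_asummable g'M _; rewrite (le_trans _ rst)// ler_nat; lia.
  congr csum; apply/funext => k.
  rewrite !npowD !npow_real mulrDr opprD expRD rmorphM /c; ring.
rewrite (halfline_integral_laplace cB ln2 c0 FE) dsumE (csum_multiples (m := m)).
- rewrite -mulN1r -csumZ; last first.
    exists (normc (npow m.+1 s) * (M * 2) * (@lnS R 1)^-1) => n.
    apply: (@le_trans _ _ ((\sum_(0 <= k < n) normc (c k)) * (@lnS R 1)^-1)).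
      rewrite mulr_suml ler_sum// => k _; rewrite normcM normc_real.
      case: (c0 k) => [->|hk]; first by rewrite normc0 !mul0r.
      have k0 : 0 < @lnS R m + @lnS R k by exact: lt_le_trans hk.
      by rewrite ler_wpM2l ?normc_ge0// ger0_norm ?invr_ge0 ?(ltW k0)// lef_pV2 ?posrE.
    by rewrite ler_wpM2r// invr_ge0 ltW.
  congr csum; apply/funext => j.
  rewrite volterra_coefE prednK ?muln_gt0// npowM /c rmorphM; ring.
- exact: polybound_asummable hM rs2.
- by move=> k /negbTE mk; rewrite /volterra_coef mk mul0r.
Qed.

Lemma volterra_monomial g m : dconvergent g ->
  volterra g (monomial m) = volterra_coef g m.
Proof.
move=> gc; have hV := is_volterra_monomial m gc.
have [h'c [s1 h'E]] : is_volterra g (monomial m) (volterra g (monomial m)).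
  by rewrite /volterra; apply: (@xgetPex _ (fun=> 0) [set h | is_volterra g (monomial m) h]);
    exists (volterra_coef g m).
have [hc [s2 hE]] := hV.
apply: (dsum_inj (sigma := Num.max s1 s2)) => // s.
by rewrite gt_max => /andP[r1 r2]; rewrite h'E// hE.
Qed.

End volterra_monomial.

(** * Singular values *)

(** Powers beat logarithms. If no K worked, then with z = K^(q/2) the logarithmic factor is at most
    (E z)^2 and the other at most D / z^4, so that K^q = z^2 <= E^2 D / c for all K > 0. *)
Lemma ln_sqr_power_bounded {R : realType} (c b A C p : R) :
  0 < c -> 0 <= b -> 0 <= A -> 0 <= C -> 0 < p ->
  exists K : nat, (0 < K)%N /\
    (ln (K ^ 2).+1%:R + b) ^+ 2 * (A / K%:R + ((C / K%:R) `^ p^-1) ^+ 2) < c.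
Proof.
move=> c0 b0 A0 C0 p0; apply/not_existsP => hK.
pose r := p^-1; have r0 : 0 < r by rewrite invr_gt0.
(* q <= 1 / 2 gives 1 / K <= K^(-2q), and q <= r gives K^(-2r) <= K^(-2q). *)
pose q := Num.min 2^-1 r.
have q0 : 0 < q by rewrite lt_min invr_gt0 r0 ltr0n.
(* [E] collects ln (x^2 + 1) <= 1 + 2 ln x, ln x <= (2 / q) z and the shift b, the constants being
   absorbed by z >= 1. *)
pose E := 1 + b + 4 / q; pose D := A + (C `^ r) ^+ 2.
have E0 : 0 <= E by rewrite !addr_ge0// divr_ge0 ?ltW.
have D0 : 0 <= D by rewrite addr_ge0// sqr_ge0.
have bound (K : nat) : (0 < K)%N -> K%:R `^ q <= E ^+ 2 * D / c.
  move=> Kp; have /not_andP[//|/negP] := hK K; rewrite -leNgt.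
  have -> : (K ^ 2).+1%:R = K%:R ^+ 2 + 1 :> R by rewrite -natr1 natrX.
  have : 1 <= K%:R :> R by rewrite ler1n.
  move: (K%:R : R) => x x1 hx.
  have x0 : 0 < x by exact: lt_le_trans x1.
  pose z := x `^ (q / 2); have z0 : 0 < z by exact: powR_gt0.
  have z1 : 1 <= z by rewrite -(powRr0 x) ler_powR// divr_ge0// ltW.
  have yE : x `^ q = z ^+ 2.
    by rewrite /z -powR_mulrn ?powR_ge0// -powRrM divfK.
  have lnx : ln x <= 2 / q * z.
    have h : q / 2 * ln x <= z.
      by rewrite -ln_powR ltW// ln_sublinear.
    have -> : 2 / q * z = (q / 2)^-1 * z by field; rewrite gt_eqF.
    by rewrite mulrC ler_pdivlMr ?divr_gt0// mulrC.
  have ln0 : 0 <= ln x by exact: ln_ge0.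
  have L0 : 0 <= ln (x ^+ 2 + 1) + b.
    by rewrite addr_ge0// ln_ge0// lerDr sqr_ge0.
  have LE : ln (x ^+ 2 + 1) + b <= E * z.
    have l1 : ln (x ^+ 2 + 1) <= 1 + 2 * ln x.
      apply: (@le_trans _ _ (ln (2 * x ^+ 2))).
        rewrite ler_ln ?posrE ?addr_gt0 ?mulr_gt0 ?exprn_gt0//.
        have : 1 <= x ^+ 2 by rewrite exprn_ege1.
        by lra.
      rewrite lnM ?posrE ?exprn_gt0// lnXn// mulr_natl lerD2r.
      by have := @le_ln1Dx R 1; apply; lra.
    have zz : (1 + b) <= (1 + b) * z by rewrite ler_peMr// addr_ge0.
    rewrite /E; have -> : (1 + b + 4 / q) * z = (1 + b) * z + 2 * (2 / q * z).
      by field; rewrite gt_eqF.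
    by lra.
  have RE : A / x + ((C / x) `^ p^-1) ^+ 2 <= D / (z ^+ 2) ^+ 2.
    rewrite -yE /D mulrDl; apply: lerD.
      rewrite ler_wpM2l// lef_pV2 ?posrE ?exprn_gt0 ?powR_gt0//.
      rewrite -powR_mulrn ?powR_ge0// -powRrM -[leRHS]powRr1 ?(ltW x0)// ler_powR//.
      by rewrite -ler_pdivlMr// mul1r ge_min lexx.
    rewrite powRM ?invr_ge0 ?(ltW x0)// exprMn ler_wpM2l ?sqr_ge0//.
    rewrite -/r -exprVn lerXn2r ?nnegrE ?powR_ge0 ?invr_ge0 ?powR_ge0//.
    have xr : x^-1 `^ r = (x `^ r)^-1.
      apply: (mulIf (_ : x `^ r != 0)); first by rewrite gt_eqF ?powR_gt0.
      by rewrite -powRM ?invr_ge0 ?(ltW x0)// !mulVf ?powR1// gt_eqF ?powR_gt0.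
    rewrite xr lef_pV2 ?posrE ?powR_gt0// ler_powR//.
    by rewrite ge_min lexx orbT.
  rewrite ler_pdivlMr// yE.
  have S0 : 0 <= A / x + ((C / x) `^ p^-1) ^+ 2.
    by rewrite addr_ge0 ?sqr_ge0// divr_ge0// ltW.
  have L2 : (ln (x ^+ 2 + 1) + b) ^+ 2 <= (E * z) ^+ 2.
    by rewrite lerXn2r ?nnegrE// mulr_ge0// ltW.
  have := le_trans hx (ler_pM (sqr_ge0 _) S0 L2 RE).
  have -> : (E * z) ^+ 2 * (D / (z ^+ 2) ^+ 2) = E ^+ 2 * D / z ^+ 2.
    by field; rewrite gt_eqF.
  by rewrite ler_pdivlMr ?exprn_gt0// mulrC.
have := bound (Num.truncn ((E ^+ 2 * D / c) `^ q^-1)).+1 isT.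
set n := (Num.truncn _).+1 => h.
have : (n%:R `^ q) `^ q^-1 <= (E ^+ 2 * D / c) `^ q^-1.
  apply: ge0_ler_powR; rewrite ?invr_ge0 ?nnegrE ?powR_ge0 ?(ltW q0)//.
  by rewrite divr_ge0 ?(ltW c0)// mulr_ge0 ?sqr_ge0.
by rewrite -powRrM mulfV ?gt_eqF// powRr1 ?ler0n// leNgt truncnS_gt.
Qed.

(** By monotonicity K s_K^p is at most the sum of the first K terms, hence at most the whole sum
    C. *)
Lemma noninc_power_decay {R : realType} (s : nat -> R) (p : R) : 0 < p ->
  (forall n, 0 <= s n) -> nonincreasing_seq s ->
  (\sum_(0 <= n <oo) (s n `^ p)%:E < +oo)%E ->
  exists2 C, 0 <= C & forall K, (0 < K)%N -> s K <= (C / K%:R) `^ p^-1.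
Proof.
move=> p0 s0 sn sf.
have S0 : (0 <= \sum_(0 <= n <oo) (s n `^ p)%:E)%E.
  by apply: nneseries_ge0 => n _ _; rewrite lee_fin powR_ge0.
exists (fine (\sum_(0 <= n <oo) (s n `^ p)%:E)%E); first exact: fine_ge0.
set C := fine _ => K K0.
have h : s K `^ p * K%:R <= C.
  apply: (@le_trans _ _ (\sum_(0 <= n < K) s n `^ p)).
    have -> : s K `^ p * K%:R = \sum_(0 <= n < K) s K `^ p.
      by rewrite sumr_const_nat subn0 mulr_natr.
    rewrite big_nat [leRHS]big_nat.
    apply: ler_sum => i /andP[_ iK]; apply: ge0_ler_powR; rewrite ?nnegrE ?(ltW p0)//.
    exact: sn (ltnW iK).
  rewrite -lee_fin /C fineK ?ge0_fin_numE// -sumEFin.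
  by apply: nneseries_lim_ge => n _ _; rewrite lee_fin powR_ge0.
have -> : s K = (s K `^ p) `^ p^-1 by rewrite -powRrM mulfV ?gt_eqF// powRr1.
apply: ge0_ler_powR; rewrite ?nnegrE ?invr_ge0 ?powR_ge0 ?(ltW p0)//.
  by rewrite divr_ge0//; exact: fine_ge0.
by rewrite ler_pdivlMr ?ltr0n.
Qed.

(** * Lower bound for T_g on monomials against its singular values *)

Section volterra_schatten.
Context {R : realType} (mu : probability (measurableTypeR R) R).
Hypothesis mu_pos : mu `]0, +oo[%classic = 1%E.
Implicit Types g : nat -> R[i].
Local Notation w := (weight mu).
Local Notation lnS := (@lnS R).

(** Only the coefficient at the integer (m + 1) (k + 1) is kept; its weight is at least w_m w_k in
    the present indexing. The factor w_m is the squared norm of the monomial and cancels on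
    normalisation. *)
Lemma A2norm_volterra_ge g m k : dconvergent g -> A2 mu (volterra g (monomial m)) ->
  normc (g k) ^+ 2 * w k * (lnS k / (lnS m + lnS k)) ^+ 2 * w m <=
    A2norm mu (volterra g (monomial m)) ^+ 2.
Proof.
move=> gc hA; have w0 := weight_gt0 mu_pos.
set n := (m.+1 * k.+1).-1.
apply: le_trans (A2norm_ge w0 n.+1 hA).
rewrite big_nat_recr//= ler_wpDl//.
  by apply: sumr_ge0 => i _; rewrite mulr_ge0 ?sqr_ge0// ltW.
rewrite volterra_monomial// volterra_coefE normcM normc_real.
set q := lnS k / _; set x := normc (g k).
have -> : x ^+ 2 * w k * q ^+ 2 * w m = x ^+ 2 * q ^+ 2 * (w m * w k) by ring.
rewrite [in leRHS](exprMn _ x) real_normK ?num_real// ler_wpM2l//.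
  by apply: mulr_ge0; exact: sqr_ge0.
exact: weight_supermul.
Qed.

(** The estimates for b_0, ..., b_{N-1} are added. On the left lnS m is replaced by the larger lnS
    N, which makes the summands equal. *)
Lemma volterra_singular_lower g k T s Tstar e K N :
  dconvergent g -> T = volterra g ->
  A2linear mu T -> A2bounded mu T -> A2adjoint mu T Tstar ->
  A2orthonormal mu e -> (forall n, 0 <= s n) -> nonincreasing_seq s ->
  (forall n, Tstar (T (e n)) = (fun k => ((s n) ^+ 2)%:C * e n k)) ->
  (forall f, A2 mu f -> (forall n, A2dot mu f (e n) = 0) -> T f = fun=> 0) ->
  N%:R * (normc (g k) ^+ 2 * w k * (lnS k / (lnS N + lnS k)) ^+ 2) <=
    s 0 ^+ 2 * K%:R + s K ^+ 2 * N%:R.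
Proof.
move=> gc TE Tl Tb Ta eo s0 sn Te Tx; have w0 := weight_gt0 mu_pos.
have [eA eO] := eo.
set c := normc (g k) ^+ 2 * w k.
have c0 : 0 <= c by rewrite mulr_ge0 ?sqr_ge0// ltW.
(* The bound for b_m, obtained by dividing the one for [monomial m] by w_m; |e_n(m)|^2 w_m is |<b_m,
   e_n>|^2. *)
have step m : c * (lnS k / (lnS m + lnS k)) ^+ 2 <=
    s 0 ^+ 2 * (\sum_(0 <= n < K) normc (e n m) ^+ 2 * w m) + s K ^+ 2.
  have [mA mN] := A2_monomial w0 m.
  have := sqr_A2norm_T_le w0 eo Tl Tb Ta s0 sn Te Tx K mA.
  have := A2norm_volterra_ge (m := m) k gc; rewrite -TE => /(_ (A2_T Tb mA)).
  move=> /le_trans/[apply]; rewrite mN -/c => h.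
  rewrite -(ler_pM2r (w0 m)) (le_trans h)// [leRHS]mulrDl lerD2r -[leRHS]mulrA.
  apply: ler_wpM2l; first exact: sqr_ge0.
  rewrite mulr_suml le_eqVlt; apply/orP; left; apply/eqP.
  apply: eq_bigr => n _; rewrite A2dot_monomial normcM normc_conj normc_real.
  by rewrite ger0_norm ?(ltW (w0 m))//; ring.
have NE (x : R) : N%:R * x = \sum_(0 <= m < N) x by rewrite sumr_const_nat subn0 mulr_natl.
apply: (@le_trans _ _ (\sum_(0 <= m < N) (s 0 ^+ 2 *
   (\sum_(0 <= n < K) normc (e n m) ^+ 2 * w m) + s K ^+ 2))).
  rewrite NE big_nat [leRHS]big_nat; apply: ler_sum => m /andP[_ mN].
  apply: le_trans (step m); rewrite ler_wpM2l//.
  have [->|k0] := eqVneq (lnS k) 0; first by rewrite !mul0r.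
  have kp : 0 < lnS k by rewrite lt_def k0 lnS_ge0.
  have dp j : 0 < lnS j + lnS k by rewrite ltr_wpDl ?lnS_ge0.
  rewrite lerXn2r ?nnegrE ?divr_ge0 ?(ltW (dp _)) ?lnS_ge0//.
  by rewrite ler_wpM2l ?lnS_ge0// lef_pV2 ?posrE// lerD2r lnS_homo// ltnW.
rewrite big_split/= -NE [N%:R * _]mulrC lerD2r -mulr_sumr ler_wpM2l ?sqr_ge0//.
(* For fixed n the sum over m is a partial sum of |e_n|^2 = 1. *)
rewrite exchange_big/=; apply: (@le_trans _ _ (\sum_(0 <= n < K) 1)).
  apply: ler_sum => n _; rewrite (le_trans (A2norm_ge w0 N (eA n)))//.
  have /complexI -> : (A2norm mu (e n) ^+ 2)%:C = 1%:C.
    by rewrite -A2dot_norm// eO eqxx.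
  by [].
by rewrite sumr_const_nat subn0.
Qed.

End volterra_schatten.

Unset Implicit Arguments.

Theorem theorem7p10 (R : realType) (mu : probability (measurableTypeR R) R)
    (mu_pos : mu `]0, +oo[%classic = 1%E) (mu_supp : msupport mu 0)
    (g : nat -> R[i]) (g_cvg : dconvergent g) (g_nc : ~ dconstant g)
    (p : R) (p_gt0 : 0 < p) :
  ~ schatten_class mu p (volterra g).
Proof.
move=> [Tl Tb _ [s [s0 sn [Tstar [e [Ta eo Te Tx]]]] sf]].
have [k k0 gk] : exists2 k, (0 < k)%N & g k != 0.
  apply: contra_notP g_nc => h k k0; apply/eqP/negPn/negP => gk.
  by apply: h; exists k.
have [C C0 sC] := noninc_power_decay p_gt0 s0 sn sf.
pose L := @lnS R k; have L0 : 0 < L by rewrite ln_gt0// ltr1n.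
pose c := normc (g k) ^+ 2 * weight mu k * L ^+ 2.
have c0 : 0 < c.
  by rewrite !mulr_gt0 ?exprn_gt0 ?normc_gt0// weight_gt0.
have [K [K0]] := ln_sqr_power_bounded c0 (ltW L0) (sqr_ge0 (s 0)) C0 p_gt0.
apply/negP; rewrite -leNgt.
(* Dividing by N = K^2 turns s_0^2 K into s_0^2 / K, the shape required by
   [ln_sqr_power_bounded]. *)
have := volterra_singular_lower mu_pos k K (K ^ 2) g_cvg erefl Tl Tb Ta eo s0 sn Te Tx.
have Kp : 0 < K%:R :> R by rewrite ltr0n.
rewrite -/L -[ln (K ^ 2).+1%:R]/(@lnS R (K ^ 2)).
set M := @lnS R (K ^ 2); rewrite natrX => h.
have ML : 0 < M + L by rewrite ltr_wpDl// lnS_ge0.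
rewrite -ler_pdivrMl ?exprn_gt0//.
apply: (@le_trans _ _ (s 0 ^+ 2 / K%:R + s K ^+ 2)); last first.
  rewrite lerD2l lerXn2r ?nnegrE ?powR_ge0//; exact: sC.
have -> : ((M + L) ^+ 2)^-1 * c = normc (g k) ^+ 2 * weight mu k * (L / (M + L)) ^+ 2.
  by rewrite /c; field; rewrite gt_eqF.
rewrite -(ler_pM2l (exprn_gt0 2 Kp)) (le_trans h)// le_eqVlt; apply/orP; left.
by apply/eqP; field; rewrite gt_eqF.
Qed.
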